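(* Let $\mathcal{D}_A \subseteq SM(\mathbb{R})^2$ be a free quadrilateral. Then there exist noncommutative polynomials $p_1,p_2,p_3,p_4$ with real coefficients in the noncommuting variables $x_1$ and $x_2$, each of degree no more than three, such that for $X\in SM(\mathbb{R})^2$ one has $X \in \partial^{\mathrm{Arv}} \mathcal{D}_A$ if and only if $X \in \mathcal{D}_A$ and $p_i (X)=0$ for each $i=1,\dots,4$.
   Context: $SM_n(\mathbb{R})^g$ denotes the set of $g$-tuples of real symmetric $n\times n$ matrices and $SM(\mathbb{R})^g=\bigcup_{n\ge 1} SM_n(\mathbb{R})^g$. For $A=(A_1,\dots,A_g)\in SM_d(\mathbb{R})^g$ and $X\in SM_n(\mathbb{R})^g$ let $L_A(X)=I_{dn}+A_1\otimes X_1+\cdots+A_g\otimes X_g$ (Kronecker products). The free spectrahedron defined by $A$ is $\mathcal{D}_A=\{X\in SM(\mathbb{R})^g : L_A(X)\succeq 0\}$, and $\mathcal{D}_A(n)=\mathcal{D}_A\cap SM_n(\mathbb{R})^g$. A free spectrahedron $K\subseteq SM(\mathbb{R})^2$ is a free quadrilateral if $K(1)\subset\mathbb{R}^2$ is a bounded quadrilateral in the classical sense and there is a pair $C=(C_1,C_2)$ of $4\times 4$ real diagonal matrices such that $K=\mathcal{D}_C$. A tuple $X\in\mathcal{D}_A(n)$ is an Arveson extreme point of $\mathcal{D}_A$ if whenever $Y=\begin{pmatrix} X&\beta\\ \beta^T&\gamma\end{pmatrix}\in\mathcal{D}_A$ (block tuple, taken coordinatewise, with $\beta\in M_{n\times m}(\mathbb{R})^g$,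 $\gamma\in SM_m(\mathbb{R})^g$, $m\ge1$) one has $\beta=0$. The Arveson boundary $\partial^{\mathrm{Arv}}\mathcal{D}_A$ is the set of all Arveson extreme points of $\mathcal{D}_A$. A noncommutative polynomial is a finite real linear combination of words in the noncommuting variables (the empty word evaluates to the identity); its degree is the length of its longest word; it is evaluated at a matrix tuple $X$ by replacing $x_i$ with $X_i$. *)

(* Defs.v *)
From HB Require Import structures.
From mathcomp Require Import all_boot all_order all_algebra.
From mathcomp Require Import finmap reals mxtens.
From mathcomp.multinomials Require Import monalg.

Set Implicit Arguments.
Unset Strict Implicit.
Unset Printing Implicit Defensive.

Import Order.TTheory GRing.Theory Num.Theory.
Local Open Scope ring_scope.

Definition mxtuple (R : Type) (g n : nat) := 'I_g -> 'M[R]_n.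

(* SM_n(R)^g; the matrix sizes range over n >= 1. *)
Definition SM (R : realType) (g n : nat) (X : mxtuple R g n) : Prop :=
  (0 < n)%N /\ forall i, (X i)^T = X i.

(* A subset K of the graded union SM(R)^g, given by its levels K(n). *)
Definition freeset (R : realType) (g : nat) :=
  forall n : nat, mxtuple R g n -> Prop.

Definition freeset_eq (R : realType) (g : nat) (K L : freeset R g) : Prop :=
  forall (n : nat) (X : mxtuple R g n), K n X <-> L n X.

Definition psdmx (R : realType) (n : nat) (M : 'M[R]_n) : Prop :=
  M^T = M /\ forall v : 'cV[R]_n, 0 <= (v^T *m M *m v) 0 0.

Definition linpencil (R : realType) (g d n : nat)
    (A : mxtuple R g d) (X : mxtuple R g n) : 'M[R]_(d * n) :=
  1%:M + \sum_(i < g) (A i *t X i).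

Definition free_spectrahedron (R : realType) (g d : nat) (A : mxtuple R g d)
    : freeset R g :=
  fun n X => SM X /\ psdmx (linpencil A X).

Definition conv_hull (R : realType) (m k : nat) (v : 'I_k -> 'rV[R]_m)
    (x : 'rV[R]_m) : Prop :=
  exists t : 'I_k -> R,
    [/\ forall j, 0 <= t j, \sum_(j < k) t j = 1
      & x = \sum_(j < k) t j *: v j].

(* A (nondegenerate) bounded convex quadrilateral: the convex hull of four
   points, each of which is a vertex, i.e. lies outside the convex hull of the
   other three.  Levels K(1) of free spectrahedra are always convex. *)
Definition quadrilateral (R : realType) (Q : 'rV[R]_2 -> Prop) : Prop :=
  exists v : 'I_4 -> 'rV[R]_2,
    (forall i : 'I_4, ~ conv_hull (fun j : 'I_3 => v (lift i j)) (v i))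
    /\ (forall x, Q x <-> conv_hull v x).

(* K(1), with 1 x 1 matrices identified with scalars. *)
Definition level1 (R : realType) (g : nat) (K : freeset R g) (x : 'rV[R]_g)
    : Prop :=
  K 1%N (fun i => (x 0 i)%:M).

Definition free_quadrilateral (R : realType) (K : freeset R 2) : Prop :=
  [/\ exists (d : nat) (A : mxtuple R 2 d),
        SM A /\ freeset_eq K (free_spectrahedron A),
      quadrilateral (level1 K)
    & exists C : mxtuple R 2 4,
        (forall i, is_diag_mx (C i)) /\ freeset_eq K (free_spectrahedron C)].

Definition dilation (R : realType) (g n m : nat) (X : mxtuple R g n)
    (beta : 'I_g -> 'M[R]_(n, m)) (gamma : mxtuple R g m)
    : mxtuple R g (n + m) :=
  fun i => block_mx (X i) (beta i) (beta i)^T (gamma i).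

Definition arveson_boundary (R : realType) (g : nat) (K : freeset R g)
    : freeset R g :=
  fun n X =>
    K n X /\
    forall (m : nat) (beta : 'I_g -> 'M[R]_(n, m)) (gamma : mxtuple R g m),
      SM gamma -> K (n + m)%N (dilation X beta gamma) ->
      forall i, beta i = 0.

(* The free algebra R<x_0, ..., x_(g-1)>, as the monoid algebra of the free
   monoid of words on 'I_g. *)
Definition ncpoly (R : realType) (g : nat) := {malg R[{fmonom 'I_g}]}.

Definition ncdeg_le (R : realType) (g : nat) (p : ncpoly R g) (k : nat)
    : Prop :=
  forall w : {fmonom 'I_g}, w \in msupp p -> (fdeg w <= k)%N.

Definition nceval (R : realType) (g n : nat) (p : ncpoly R g)
    (X : mxtuple R g n) : 'M[R]_n :=
  \sum_(w <- msupp p) p@_w *: \prod_(i <- (w : seq 'I_g)) X i.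

(* Main.v *)
(* Write the sides of the quadrilateral as affine forms f1, ..., f4 in cyclic order,
   rescaled so that f1 + f3 = f2 + f4 = m, and expand 1 = a f1 + b f2 + d m. For X in
   the spectrahedron put Li = fi(X) >= 0; then M = m(X) is positive definite, and a
   dimension count shows that X is Arveson extreme iff rank L1 + rank L3 <= n and
   rank L2 + rank L4 <= n, i.e. iff L1 M^-1 L3 = L2 M^-1 L4 = 0, i.e. iff M^-1 L1
   and M^-1 L2 are idempotent. The algebra generated by two idempotents is so small
   that M^-1 can then be traded for an affine form w positive on the quadrilateral:
   f1 w f3 vanishes at X. Conversely L1 W L3 = 0 with W = w(X) invertible gives back
   rank L1 + rank L3 <= n. The second pair of sides is symmetric, so two cubics
   suffice, and they are repeated to make up four. *)
Require Import Defs.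
From HB Require Import structures.
From mathcomp Require Import all_boot all_order all_algebra.
From mathcomp Require Import reals.
From mathcomp Require Import finmap mxtens.
From mathcomp.multinomials Require Import monalg.
From mathcomp Require Import ring lra zify.

Set Implicit Arguments.
Unset Strict Implicit.
Unset Printing Implicit Defensive.

Import Order.TTheory GRing.Theory Num.Theory.
Local Open Scope ring_scope.

(** * Positive semidefinite matrices *)

(** Put E = M^-1 L1 and F = M^-1 L2; the expansion of 1 becomes N = M^-1 = a E + b F + d. With t = a
    + b + 2d, the product N (t - N) is a scalar plus a multiple of (E - F)^2, which commutes with E
    and F, so M equals t - N up to a central unit. For W affine in F, the product E M W M (1 - E) is
    therefore, up to units, E p(F) (1 - E) with p a polynomial, and it vanishes as soon as p(0) =
    p(1). This condition determines W, hence w, up to a factor. A separate obstacle is geometric: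
    the hypotheses give four half-planes and four corners without any order. Each corner lies on two
    nonparallel sides and no side carries three corners, which forces the incidences to form a
    4-cycle; that supplies the cyclic order. *)

Definition qform (R : realType) (n : nat) (M : 'M[R]_n) (v : 'cV[R]_n) : R :=
  (v^T *m M *m v) 0 0.

Lemma qformD (R : realType) n (A B : 'M[R]_n) (v : 'cV[R]_n) :
  qform (A + B) v = qform A v + qform B v.
Proof. by rewrite /qform mulmxDr mulmxDl mxE. Qed.

Lemma qformZ (R : realType) n (c : R) (A : 'M[R]_n) (v : 'cV[R]_n) :
  qform (c *: A) v = c * qform A v.
Proof. by rewrite /qform -scalemxAr -scalemxAl mxE. Qed.

Lemma sqnorm_eq0 (R : realType) n (v : 'cV[R]_n) : ((v^T *m v) 0 0 == 0) = (v == 0).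
Proof.
apply/idP/eqP => [|->]; last by rewrite mulmx0 mxE.
rewrite mxE psumr_eq0 => [/allP h|i _]; last by rewrite mxE -expr2 sqr_ge0.
apply/colP => i; rewrite mxE.
by have := h i (mem_index_enum i); rewrite mxE mulf_eq0 orbb => /eqP.
Qed.

Lemma sqnorm_ge0 (R : realType) n (v : 'cV[R]_n) : 0 <= (v^T *m v) 0 0.
Proof. by rewrite mxE sumr_ge0 // => i _; rewrite mxE -expr2 sqr_ge0. Qed.

Lemma psdmx_ker (R : realType) n (M : 'M[R]_n) (v : 'cV[R]_n) :
  psdmx M -> qform M v = 0 -> M *m v = 0.
Proof.
move=> [sM pM] v0; apply/eqP; rewrite -sqnorm_eq0.
set w := M *m v; set b := (w^T *m w) 0 0.
have expand t : qform M (v + t *: w) = 2 * t * b + t ^+ 2 * qform M w.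
  have trE : (v + t *: w)^T = v^T + t *: w^T by rewrite linearD linearZ.
  rewrite /qform trE !mulmxDl !mulmxDr -!scalemxAl -!scalemxAr.
  rewrite -[v^T *m M *m w]mulmxA.
  have -> : v^T *m (M *m w) = w^T *m w by rewrite /w trmx_mul sM mulmxA.
  have -> : w^T *m M *m v = w^T *m w by rewrite /w mulmxA.
  have entry (A B C : 'M[R]_1) : (A + t *: B + (t *: B + t *: (t *: C))) 0 0 =
      A 0 0 + 2 * t * B 0 0 + t ^+ 2 * C 0 0 by rewrite !mxE; ring.
  by rewrite entry -/(qform M v) v0 add0r.
have b0 : 0 <= b by apply: sqnorm_ge0.
have c0 : 0 <= qform M w by apply: pM.
set c := qform M w in expand c0 *.
have h t : 0 <= 2 * t * b + t ^+ 2 * c by rewrite -expand; apply: pM.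
rewrite -/b eq_le b0 andbT.
have c1 : 0 < c + 1 by lra.
(* Almost the minimiser of the quadratic in [t]; the [+ 1] keeps the denominator positive when
   [c = 0]. The value there is [- b ^+ 2 * s * (1 + s)], which forces [b = 0]. *)
have := h (- b / (c + 1)).
set s := (c + 1)^-1.
have sE : (c + 1) * s = 1 by rewrite mulfV // gt_eqF.
have s0 : 0 < s by rewrite invr_gt0.
move=> hh.
have {hh}: 0 <= b ^+ 2 * s * (s * c - 2) by move: hh; congr (0 <= _); ring.
have sc : s * c = 1 - s by move: sE; lra.
rewrite sc => hh; nra.
Qed.

Lemma psdmxD (R : realType) n (A B : 'M[R]_n) :
  psdmx A -> psdmx B -> psdmx (A + B).
Proof.
move=> [sA pA] [sB pB]; split=> [|v]; first by rewrite raddfD /= sA sB.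
by rewrite -/(qform _ v) qformD addr_ge0 //; [apply: pA|apply: pB].
Qed.

Lemma psdmxZ (R : realType) n (c : R) (A : 'M[R]_n) :
  0 <= c -> psdmx A -> psdmx (c *: A).
Proof.
move=> c0 [sA pA]; split=> [|v]; first by rewrite linearZ /= sA.
by rewrite -/(qform _ v) qformZ mulr_ge0 //; apply: pA.
Qed.

Lemma psdmx_addl_ker (R : realType) n (A B : 'M[R]_n) (v : 'cV[R]_n) :
  psdmx A -> psdmx B -> (A + B) *m v = 0 -> A *m v = 0.
Proof.
move=> psA psB h; apply: psdmx_ker => //; apply/eqP.
have := psA.2 v; have := psB.2 v; rewrite -!/(qform _ _) => b0 a0.
have : qform (A + B) v = 0 by rewrite /qform -mulmxA h mulmx0 mxE.
by rewrite qformD => /eqP; rewrite paddr_eq0 // => /andP[].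
Qed.

Lemma unitmx_ker0 (R : fieldType) n (A : 'M[R]_n) :
  (forall v : 'cV_n, A *m v = 0 -> v = 0) -> A \in unitmx.
Proof.
move=> h; rewrite -unitmx_tr -row_free_unit -kermx_eq0.
apply/eqP/row_matrixP => i; rewrite row0; apply: trmx_inj; rewrite trmx0.
apply: h; apply: trmx_inj.
by rewrite trmx_mul trmxK -row_mul mulmx_ker row0 trmx0.
Qed.

Definition posdefmx (R : realType) n (A : 'M[R]_n) := psdmx A /\ A \in unitmx.

Lemma posdefmxDr (R : realType) n (A B : 'M[R]_n) :
  psdmx A -> posdefmx B -> posdefmx (A + B).
Proof.
move=> psA [psB uB]; split; first exact: psdmxD.
apply: unitmx_ker0 => v; rewrite addrC => /(psdmx_addl_ker psB psA) h.
by rewrite -(mulKmx uB v) h mulmx0.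
Qed.

Lemma posdefmxZ (R : realType) n (c : R) (A : 'M[R]_n) :
  0 < c -> posdefmx A -> posdefmx (c *: A).
Proof.
by move=> c0 [psA uA]; split; [apply: psdmxZ => //; apply: ltW|rewrite unitmxZ // unitfE gt_eqF].
Qed.

Lemma mxrank_unit_add (F : fieldType) n (A B : 'M[F]_n) :
  A + B \in unitmx -> (n <= \rank A + \rank B)%N.
Proof.
by move=> u; rewrite -[X in (X <= _)%N](mxrank_unit u) mxrank_add.
Qed.

Lemma unitmx_mul_between (F : fieldType) n (A W B : 'M[F]_n) :
  W \in unitmx -> A *m W *m B = 0 -> (\rank A + \rank B <= n)%N.
Proof.
move=> uW h; have := mulmx0_rank_max h.
by rewrite mxrankMfree // row_free_unit.
Qed.

(** The vanishing matrix is the parallel sum of [A] and [B]. Their left kernels meet trivially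
    because [M = A + B] is invertible, and the rank bound makes them span, so [1 = K + L] with
    [K A = 0] and [L B = 0]. Then [L A = L M], and [A M^-1 B = L M M^-1 B = L B = 0]. *)
Lemma parallel_sum0 (F : fieldType) n (A B : 'M[F]_n) :
  A + B \in unitmx -> (\rank A + \rank B <= n)%N ->
  A *m invmx (A + B) *m B = 0.
Proof.
move=> u le_n; set M := A + B in u *.
have cap0 : (kermx A :&: kermx B)%MS = 0.
  apply/eqP; rewrite -submx0; apply/rV_subP => v; rewrite sub_capmx.
  move=> /andP[/sub_kermxP vA /sub_kermxP vB].
  by rewrite -(mulmxK u v) mulmxDr vA vB addr0 mul0mx sub0mx.
have full : (1%:M <= kermx A + kermx B)%MS.
  rewrite sub1mx /row_full eqn_leq rank_leq_col /=.
  have := mxrank_sum_cap (kermx A) (kermx B); rewrite cap0 mxrank0 addn0 => ->.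
  rewrite !mxrank_ker; have := rank_leq_row A; have := rank_leq_row B; lia.
have [[P Q] /= PQ] := sub_addsmxP full.
have {PQ}[K [L [KA LB KL]]] :
    exists K L : 'M_n, [/\ K *m A = 0, L *m B = 0 & 1%:M = K + L].
  exists (P *m kermx A), (Q *m kermx B).
  by split=> //; rewrite -mulmxA mulmx_ker mulmx0.
have LA : L *m A = L *m M by rewrite mulmxDr LB addr0.
by rewrite -[LHS]mul1mx KL mulmxDl !mulmxA KA LA mulmxK // LB !mul0mx addr0.
Qed.

(** Once the parallel sum vanishes, [A (A + B)^-1] is a projection that fixes the columns of [A] and
    kills those of [B]. *)
Lemma parallel_sum0_split (F : fieldType) n m (A B : 'M[F]_n) (z w : 'M[F]_(n, m)) :
  A + B \in unitmx -> A *m invmx (A + B) *m B = 0 ->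
  A *m invmx (A + B) *m (A *m z + B *m w) = A *m z.
Proof.
move=> u h; rewrite mulmxDr !mulmxA h mul0mx addr0.
have -> : A *m invmx (A + B) *m A = A *m invmx (A + B) *m (A + B).
  by rewrite mulmxDr h addr0.
by rewrite mulmxKV.
Qed.

(** * Two idempotents *)

Lemma idempotent_affine_mul (R : comRingType) n (E : 'M[R]_n) (x y z w : R) :
  E *m E = E ->
  (x%:M + y *: E) *m (z%:M + w *: E) = (x * z)%:M + (x * w + y * z + y * w) *: E.
Proof.
move=> EE; rewrite mulmxDl !mulmxDr -!scalemxAl -!scalemxAr EE.
rewrite !mul_scalar_mx !mul_mx_scalar.
by apply/matrixP => i j; rewrite !mxE; ring.
Qed.

(** [D] works out as the scalar [d (a + b + d)] plus [a b (E - F)^2], and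
    [E (E - F)^2 = E - E F E = (E - F)^2 E]. *)
Lemma two_idempotents_central (R : comRingType) n (E F : 'M[R]_n) (a b d : R) :
  E *m E = E -> F *m F = F ->
  let N := a *: E + b *: F + d%:M in
  let D := N *m ((a + b + 2 * d)%:M - N) in D *m E = E *m D.
Proof.
move=> EE FF N D.
have DE : D = (d * (a + b + d))%:M + (a * b) *: (E + F - E *m F - F *m E).
  rewrite /D /N mulmxBr mul_mx_scalar !(mulmxDl, mulmxDr).
  rewrite -!(scalemxAl, scalemxAr) EE FF !mul_scalar_mx !mul_mx_scalar.
  move: (E *m F) (F *m E) => EF FE.
  by apply/matrixP => i j; rewrite !mxE; ring.
rewrite DE mulmxDl mulmxDr -scalemxAl -scalemxAr scalar_mxC; congr (_ + _ *: _).
rewrite !mulmxBl !mulmxBr mulmxDl mulmxDr !mulmxA. rewrite EE -[F *m E *m E]mulmxA. rewrite EE.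
move: (E *m F) (F *m E) (E *m F *m E) => EF FE EFE.
by apply/matrixP => i j; rewrite !mxE; ring.
Qed.

(* Multiplying on both sides by the central element [N (t - N)], where
   [t = a + b + 2d], replaces [M] by [t - N]; between [E] and [1 - E] this leaves
   a polynomial in [F], which takes equal values at [0] and [1]. *)
Lemma two_idempotents_cubic (K : fieldType) n (E F M : 'M[K]_n) (a b d : K) :
  E *m E = E -> F *m F = F ->
  let N := a *: E + b *: F + d%:M in
  M *m N = 1%:M -> (a + b + 2 * d)%:M - N \in unitmx ->
  E *m M *m ((b * (a + b + 2 * d)) *: F + (d * (a + d))%:M) *m M *m (1%:M - E) = 0.
Proof.
move=> EE FF N MN uN; set t := a + b + 2 * d in uN *.
set G := 1%:M - E; set W := _ *: F + _.
have NM : N *m M = 1%:M by apply: mulmx1C.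
pose D := N *m (t%:M - N).
have DE : D *m E = E *m D by apply: two_idempotents_central.
have NC : N *m (t%:M - N) = (t%:M - N) *m N.
  by rewrite mulmxBr mulmxBl scalar_mxC.
have MD : M *m D = t%:M - N by rewrite /D mulmxA MN mul1mx.
have DM : D *m M = t%:M - N by rewrite /D NC -mulmxA NM mulmx1.
have uD : D \in unitmx.
  by rewrite unitmx_mul uN andbT; have [] := mulmx1_unit MN.
have GD : G *m D = D *m G by rewrite mulmxBl mulmxBr DE mul1mx mulmx1.
have EG : E *m G = 0 by rewrite mulmxBr mulmx1 EE subrr.
have EtN : E *m (t%:M - N) = E *m ((b + d)%:M + (- b) *: F).
  rewrite /N mulmxBr !mulmxDr -!scalemxAr EE !mul_mx_scalar.
  by move: (E *m F) => EF; apply/matrixP => i j; rewrite !mxE /t; ring.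
have tNG : (t%:M - N) *m G = ((a + b + d)%:M + (- b) *: F) *m G.
  have -> : t%:M - N = (a + b + d)%:M + - b *: F - a *: E.
    by rewrite /N /t; apply/matrixP => i j; rewrite !mxE; ring.
  by rewrite mulmxBl -scalemxAl EG scaler0 subr0.
have WE : W = (d * (a + d))%:M + (b * t) *: F by rewrite addrC.
have key : D *m (E *m M *m W *m M *m G) *m D = 0.
  rewrite !mulmxA DE -[E *m D *m M]mulmxA DM EtN -!mulmxA GD.
  rewrite [M *m (D *m G)]mulmxA MD tNG [W *m _]mulmxA WE.
  rewrite !mulmxA -[E *m _ *m _]mulmxA idempotent_affine_mul //.
  rewrite -[E *m _ *m _]mulmxA idempotent_affine_mul //.
  set c := (X in _ + X *: F).
  have -> : c = 0 by rewrite /c /t; ring.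
  by rewrite scale0r addr0 mul_mx_scalar -scalemxAl EG scaler0.
by rewrite -(mulKmx uD (_ *m G)) -(mulmxK uD (D *m _)) key mul0mx mulmx0.
Qed.

(** * Four forms bounding a quadrilateral *)

(* For linear forms [l1, ..., l4] bounding a quadrilateral in cyclic order,
   suitably rescaled, [1 / d], [1 / (a + d)], [1 / (b + d)], [1 / (a + b + d)] are
   the values of [l1 + l3] at the four vertices. *)
Record quad_frame (R : realType) (V : lmodType R) (e l1 l2 l3 l4 : V) (a b d : R)
    : Prop := QuadFrame {
  quad_frame_sum : l1 + l3 = l2 + l4;
  quad_frame_unit : e = a *: l1 + b *: l2 + d *: (l1 + l3);
  quad_frame_gt0 : [/\ 0 < d, 0 < a + d, 0 < b + d & 0 < a + b + d] }.

(** Reversing the cyclic order exchanges the two pairs of opposite sides; the second cubic is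
    obtained from the first in this way. *)
Lemma quad_frame_sym (R : realType) (V : lmodType R) (e l1 l2 l3 l4 : V) (a b d : R) :
  quad_frame e l1 l2 l3 l4 a b d -> quad_frame e l2 l1 l4 l3 b a d.
Proof.
case=> s u [h1 h2 h3 h4]; split; first by [].
  by rewrite u s [b *: l2 + _]addrC.
by rewrite [b + a]addrC.
Qed.

(** Frames live in an arbitrary module so that one relation between affine forms can be carried both
    to their values at [X], where the unit becomes the identity matrix, and to the off-diagonal
    blocks of a dilation, where it becomes 0. *)
Lemma quad_frame_linear (R : realType) (V W : lmodType R) (f : {linear V -> W})
    (e l1 l2 l3 l4 : V) (a b d : R) :
  quad_frame e l1 l2 l3 l4 a b d ->
  quad_frame (f e) (f l1) (f l2) (f l3) (f l4) a b d.
Proof. by case=> s u h; split; rewrite -?linearD ?s // u s !linearD !linearZ. Qed.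

(** This is [d (a + d) m] where [l = 0] and [(b + d) (a + b + d) m] where [l = m]. With these two
    coefficients, the polynomial in [F] from the two-idempotent identity has the common value
    [d (a + d) (b + d) (a + b + d)] at 0 and at 1. The frame inequalities make both coefficients
    positive. *)
Definition weight (R : realType) (V : lmodType R) (a b d : R) (l m : V) : V :=
  (b * (a + b + 2 * d)) *: l + (d * (a + d)) *: m.

(** The matrix is [(x + y) A + y B] with positive coefficients. Definiteness is known only for
    [A + B], so the sign of [x] decides whether a multiple of [A] or of [B] is split off as the
    semidefinite remainder. *)
Lemma posdefmx_weighted (R : realType) n (A B : 'M[R]_n) (x y : R) :
  psdmx A -> psdmx B -> posdefmx (A + B) -> 0 < y -> 0 < x + y ->
  posdefmx (x *: A + y *: (A + B)).
Proof.
move=> psA psB pM y0 xy0; case: (leP 0 x) => [x0|/ltW x0].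
  by apply: posdefmxDr; [apply: psdmxZ|apply: posdefmxZ].
have -> : x *: A + y *: (A + B) = (- x) *: B + (x + y) *: (A + B).
  by apply/matrixP => i j; rewrite !mxE; ring.
by apply: posdefmxDr; [apply: psdmxZ => //; rewrite oppr_ge0|apply: posdefmxZ].
Qed.

(** A vector killed by [L1 + L3 = L2 + L4] is killed by each semidefinite summand, hence by the
    combination that equals the identity. *)
Lemma quad_frame_posdef (R : realType) n (L1 L2 L3 L4 : 'M[R]_n) (a b d : R) :
  quad_frame 1%:M L1 L2 L3 L4 a b d ->
  psdmx L1 -> psdmx L2 -> psdmx L3 -> psdmx L4 -> posdefmx (L1 + L3).
Proof.
move=> [s u _] p1 p2 p3 p4; split; first exact: psdmxD.
apply: unitmx_ker0 => v Mv; have M'v := Mv; rewrite s in M'v.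
rewrite -(mul1mx v) u !mulmxDl -!scalemxAl Mv.
by rewrite (psdmx_addl_ker p1 p3 Mv) (psdmx_addl_ker p2 p4 M'v) !scaler0 !addr0.
Qed.

Lemma quad_frame_weight_posdef (R : realType) n (L1 L2 L3 L4 : 'M[R]_n) (a b d : R) :
  quad_frame 1%:M L1 L2 L3 L4 a b d ->
  psdmx L1 -> psdmx L2 -> psdmx L3 -> psdmx L4 ->
  posdefmx (weight a b d L2 (L1 + L3)).
Proof.
move=> Q p1 p2 p3 p4; have := quad_frame_posdef Q p1 p2 p3 p4.
case: Q => s _ [h1 h2 h3 h4]; rewrite /weight s => pM.
apply: posdefmx_weighted => //; first exact: mulr_gt0.
have -> : b * (a + b + 2 * d) + d * (a + d) = (b + d) * (a + b + d) by ring.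
exact: mulr_gt0.
Qed.

Lemma quad_frame_cubic (R : realType) n (L1 L2 L3 L4 : 'M[R]_n) (a b d : R) :
  quad_frame 1%:M L1 L2 L3 L4 a b d ->
  psdmx L1 -> psdmx L2 -> psdmx L3 -> psdmx L4 ->
  (\rank L1 + \rank L3 <= n)%N -> (\rank L2 + \rank L4 <= n)%N ->
  L1 *m weight a b d L2 (L1 + L3) *m L3 = 0.
Proof.
move=> Q p1 p2 p3 p4 r13 r24; have pM := quad_frame_posdef Q p1 p2 p3 p4.
case: Q => s u [h1 h2 h3 h4].
have p0 := parallel_sum0 pM.2 r13.
have q0 : L2 *m invmx (L2 + L4) *m L4 = 0 by apply: parallel_sum0 => //; rewrite -s pM.2.
rewrite -s in q0; set M := L1 + L3 in pM u p0 q0 *.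
set N := invmx M in p0 q0; have NM : N *m M = 1%:M by rewrite mulVmx ?pM.2.
have MN : M *m N = 1%:M by rewrite mulmxV ?pM.2.
have L3E : L3 = M - L1 by rewrite addrC addKr.
have L4E : L4 = M - L2 by rewrite /M s addrC addKr.
have idem L : L *m N *m (M - L) = 0 -> (N *m L) *m (N *m L) = N *m L.
  move=> h; rewrite -mulmxA [L *m _]mulmxA.
  have -> : L *m N *m L = L *m N *m M - L *m N *m (M - L) by rewrite -mulmxBr opprB addrC subrK.
  by rewrite h subr0 -(mulmxA L) NM mulmx1.
have EE : (N *m L1) *m (N *m L1) = N *m L1 by apply: idem; rewrite -L3E.
have FF : (N *m L2) *m (N *m L2) = N *m L2 by apply: idem; rewrite -L4E.
have NE : N = a *: (N *m L1) + b *: (N *m L2) + d%:M.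
  by rewrite -[LHS]mulmx1 u !mulmxDr -!scalemxAr NM scalemx1.
have ME (L : 'M_n) : M *m (N *m L) = L by rewrite mulmxA MN mul1mx.
pose t := a + b + 2 * d.
(* [t - N] is [N] times [t M - 1], and [t M - 1] is the expansion of 1 with every side replaced by
   its opposite. It is positive definite by the four frame inequalities, with a case split on the
   sign of [a]. *)
have uT : t%:M - N \in unitmx.
  have -> : t%:M - N = N *m (a *: L3 + (b *: L4 + d *: M)).
    rewrite L3E L4E -{1}[N]mulmx1 {1}u.
    have -> : t%:M = N *m (t *: M) by rewrite -scalemxAr NM scalemx1.
    by rewrite -mulmxBr; congr (_ *m _); apply/matrixP => i j; rewrite !mxE /t; ring.
  rewrite unitmx_mul unitmx_inv pM.2 /=.
  have pM' : posdefmx (L4 + L2) by rewrite addrC -s.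
  have MC : M = L4 + L2 by rewrite /M s addrC.
  case: (leP 0 a) => [a0|/ltW a0].
    rewrite MC; apply: (posdefmxDr (psdmxZ a0 p3) _).2.
    exact: posdefmx_weighted.
  have -> : a *: L3 + (b *: L4 + d *: M) = (- a) *: L1 + (b *: L4 + (a + d) *: M).
    by rewrite L3E; apply/matrixP => i j; rewrite !mxE; ring.
  rewrite MC; apply: (posdefmxDr (psdmxZ _ p1) _).2; first by rewrite oppr_ge0.
  by apply: posdefmx_weighted => //; rewrite addrCA addrA.
have := two_idempotents_cubic (a := a) (b := b) (d := d) EE FF.
rewrite -NE => /(_ M MN uT) C.
(* With [E = N L1] and [F = N L2], the three factors are [M E], [M] times an affine expression in
   [F], and [M (1 - E)]; the product is [M] times the expression just shown to vanish. *)
rewrite -{1}(ME L1) {1}L3E.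
have -> : M - L1 = M *m (1%:M - N *m L1) by rewrite mulmxBr mulmx1 ME.
have -> : weight a b d L2 M = M *m ((b * t) *: (N *m L2) + (d * (a + d))%:M).
  by rewrite mulmxDr -scalemxAr ME mul_mx_scalar.
by rewrite -(mulmx0 _ M) -C !mulmxA.
Qed.

(** Let [T] be the common sum of opposite terms. The projections give [L1 N T = L1 z1] and
    [L2 N T = L2 z2], so multiplying [N T] by the expansion of the identity yields the expansion of
    0. Hence [N T = 0], and both terms vanish. *)
Lemma quad_frame_rigid (R : realType) n m (L1 L2 L3 L4 : 'M[R]_n)
    (z1 z2 z3 z4 : 'M[R]_(n, m)) (a b d : R) :
  quad_frame 1%:M L1 L2 L3 L4 a b d ->
  psdmx L1 -> psdmx L2 -> psdmx L3 -> psdmx L4 ->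
  (\rank L1 + \rank L3 <= n)%N -> (\rank L2 + \rank L4 <= n)%N ->
  quad_frame 0 (L1 *m z1) (L2 *m z2) (L3 *m z3) (L4 *m z4) a b d ->
  L1 *m z1 = 0 /\ L2 *m z2 = 0.
Proof.
move=> Q p1 p2 p3 p4 r13 r24 [s' u' _]; have pM := quad_frame_posdef Q p1 p2 p3 p4.
case: Q => s u _.
have uM' : L2 + L4 \in unitmx by rewrite -s pM.2.
have h1 := parallel_sum0_split z1 z3 pM.2 (parallel_sum0 pM.2 r13).
have h2 := parallel_sum0_split z2 z4 uM' (parallel_sum0 uM' r24).
rewrite -s' -s in h2; set T := L1 *m z1 + L3 *m z3 in h1 h2 u'.
set N := invmx (L1 + L3) in h1 h2.
suff T0 : N *m T = 0 by rewrite -h1 -h2 -!mulmxA T0 !mulmx0.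
rewrite -(mul1mx (N *m T)) u !mulmxDl -!scalemxAl !mulmxA h1 h2.
by rewrite mulmxV ?pM.2 // mul1mx -u'.
Qed.

(** * Arveson extreme points of intersections of half-spaces *)

Definition affmx (R : realType) (g n : nat) (X : mxtuple R g n) (f : 'rV[R]_g.+1)
    : 'M[R]_n := (f 0 0)%:M + \sum_(i < g) f 0 (lift 0 i) *: X i.

(** The off-diagonal block of an affine form at a dilation: constant terms enter only the diagonal
    blocks, so only the homogeneous part of [f] survives. *)
Definition difmx (R : realType) (g n m : nat) (beta : 'I_g -> 'M[R]_(n, m))
    (f : 'rV[R]_g.+1) : 'M[R]_(n, m) := \sum_(i < g) f 0 (lift 0 i) *: beta i.

Lemma difmx_is_linear (R : realType) g n m (beta : 'I_g -> 'M[R]_(n, m)) :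
  linear (difmx beta).
Proof.
move=> c f h; rewrite /difmx scaler_sumr -big_split; apply: eq_bigr => i _ /=.
by rewrite !mxE scalerDl scalerA.
Qed.

HB.instance Definition _ (R : realType) g n m (beta : 'I_g -> 'M[R]_(n, m)) :=
  GRing.isLinear.Build R _ _ _ (difmx beta) (difmx_is_linear beta).

Lemma affmx_is_linear (R : realType) g n (X : mxtuple R g n) : linear (affmx X).
Proof.
move=> c f h; rewrite /affmx -!/(difmx X _) linearP scalerDr addrACA; congr (_ + _).
by apply/matrixP => i j; rewrite !mxE mulrnDl mulrnAr.
Qed.

HB.instance Definition _ (R : realType) g n (X : mxtuple R g n) :=
  GRing.isLinear.Build R _ _ _ (affmx X) (affmx_is_linear X).

Lemma affmx_delta0 (R : realType) g n (X : mxtuple R g n) :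
  affmx X (delta_mx 0 0) = 1%:M.
Proof.
rewrite /affmx mxE !eqxx big1 ?addr0 // => i _.
by rewrite mxE /= scale0r.
Qed.

Lemma difmx_delta0 (R : realType) g n m (beta : 'I_g -> 'M[R]_(n, m)) :
  difmx beta (delta_mx 0 0) = 0.
Proof. by rewrite /difmx big1 // => i _; rewrite mxE /= scale0r. Qed.

Lemma difmxZ (R : realType) g n m (beta : 'I_g -> 'M[R]_(n, m)) (c : R) f :
  difmx (fun i => c *: beta i) f = c *: difmx beta f.
Proof.
by rewrite /difmx scaler_sumr; apply: eq_bigr => i _; rewrite !scalerA mulrC.
Qed.

Lemma affmx_tr (R : realType) g n (X : mxtuple R g n) f :
  SM X -> (affmx X f)^T = affmx X f.
Proof.
move=> [_ sX]; rewrite /affmx linearD /= tr_scalar_mx linear_sum /=.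
by congr (_ + _); apply: eq_bigr => i _; rewrite linearZ /= sX.
Qed.

Lemma affmx_dilation (R : realType) g n m (X : mxtuple R g n)
    (beta : 'I_g -> 'M[R]_(n, m)) (gamma : mxtuple R g m) f :
  affmx (dilation X beta gamma) f =
  block_mx (affmx X f) (difmx beta f) (difmx beta f)^T (affmx gamma f).
Proof.
rewrite /affmx /difmx scalar_mx_block.
suff -> : \sum_(i < g) f 0 (lift 0 i) *: dilation X beta gamma i =
    block_mx (\sum_(i < g) f 0 (lift 0 i) *: X i) (difmx beta f) (difmx beta f)^T
      (\sum_(i < g) f 0 (lift 0 i) *: gamma i).
  by rewrite add_block_mx !add0r.
rewrite /difmx; elim: (index_enum _) => [|i s IH].
  by rewrite !big_nil trmx0 block_mx0.
by rewrite !big_cons IH scale_block_mx add_block_mx !linearD !linearZ.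
Qed.

Definition diag_form (R : realType) (g d : nat) (C : mxtuple R g d) (k : 'I_d)
    : 'rV[R]_g.+1 := \row_j oapp (fun i => C i k k) 1 (unlift 0 j).

Lemma diag_form0 (R : realType) g d (C : mxtuple R g d) k : diag_form C k 0 0 = 1.
Proof. by rewrite mxE unlift_none. Qed.

Lemma linpencil_diagE (R : realType) g d n (C : mxtuple R g d) (X : mxtuple R g n)
    k l p q : (forall i, is_diag_mx (C i)) ->
  linpencil C X (mxtens_index (k, p)) (mxtens_index (l, q)) =
  affmx X (diag_form C k) p q *+ (k == l).
Proof.
move=> dC; rewrite /linpencil /affmx diag_form0 !mxE !summxE.
rewrite (can_eq (@mxtens_indexK d n)) xpair_eqE.
have -> : \sum_(i < g) (C i *t X i) (mxtens_index (k, p)) (mxtens_index (l, q)) =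
    \sum_(i < g) (diag_form C k 0 (lift 0 i) *: X i) p q *+ (k == l).
  apply: eq_bigr => i _; rewrite tensmxE !mxE liftK /=.
  have [<-|kl] := eqVneq k l; first by rewrite mulr1n.
  by move/is_diag_mxP: (dC i) => -> //; rewrite mul0r.
by rewrite sumrMnl mulrnDl; case: (k == l); rewrite /= ?mulr1n ?mulr0n.
Qed.

Lemma qformE (R : realType) n (M : 'M[R]_n) v :
  qform M v = \sum_i \sum_j v i 0 * M i j * v j 0.
Proof.
rewrite /qform mxE exchange_big; apply: eq_bigr => j _ /=.
by rewrite mxE mulr_suml; apply: eq_bigr => i _; rewrite mxE.
Qed.

Lemma big_mxtens_index (R : realType) d n (F : 'I_(d * n) -> R) :
  \sum_i F i = \sum_k \sum_p F (mxtens_index (k, p)).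
Proof.
rewrite pair_big (reindex (@mxtens_index d n)) /=; last first.
  by exists (@mxtens_unindex d n) => i _; rewrite (mxtens_indexK, mxtens_unindexK).
by apply: eq_bigr => -[].
Qed.

Lemma qform_linpencil_diag (R : realType) g d n (C : mxtuple R g d)
    (X : mxtuple R g n) v : (forall i, is_diag_mx (C i)) ->
  qform (linpencil C X) v =
  \sum_k qform (affmx X (diag_form C k)) (\col_p v (mxtens_index (k, p)) 0).
Proof.
move=> dC; rewrite qformE big_mxtens_index; apply: eq_bigr => k _.
rewrite qformE; apply: eq_bigr => p _; rewrite big_mxtens_index (bigD1 k) //=.
rewrite [X in _ + X]big1 ?addr0 => [|l kl]; last first.
  apply: big1 => q _; rewrite linpencil_diagE // eq_sym (negbTE kl).
  by rewrite mulr0 mul0r.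
by apply: eq_bigr => q _; rewrite linpencil_diagE // eqxx !mxE.
Qed.

Lemma psdmx_linpencil_diag (R : realType) g d n (C : mxtuple R g d)
    (X : mxtuple R g n) : (forall i, is_diag_mx (C i)) -> SM X ->
  psdmx (linpencil C X) <-> forall k, psdmx (affmx X (diag_form C k)).
Proof.
move=> dC sX; split=> [[_ h] k|h].
  split=> [|v]; first exact: affmx_tr.
  (* Testing on a vector supported in the [k]-th block isolates the [k]-th form. *)
  pose w : 'cV[R]_(d * n) := \col_i
    (if (mxtens_unindex i).1 == k then v (mxtens_unindex i).2 0 else 0).
  have := h w; rewrite -/(qform _ _) qform_linpencil_diag // (bigD1 k) //=.
  rewrite big1 ?addr0 => [|l lk].
    by congr (0 <= qform _ _); apply/colP => p; rewrite !mxE mxtens_indexK /= eqxx.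
  have -> : \col_p w (mxtens_index (l, p)) 0 = 0.
    by apply/colP => p; rewrite !mxE mxtens_indexK /= (negbTE lk).
  by rewrite /qform mulmx0 mxE.
split=> [|v].
  apply/matrixP => i j; rewrite mxE.
  case: (mxtens_indexP i) => k p; case: (mxtens_indexP j) => l q.
  rewrite !linpencil_diagE // eq_sym; have [->|_] := eqVneq k l; last by [].
  by rewrite -[in LHS](affmx_tr _ sX) mxE.
rewrite -/(qform _ _) qform_linpencil_diag //; apply: sumr_ge0 => k _.
by have [_] := h k; apply.
Qed.

(** If [L v = 0], then [(v, 0)] is isotropic for a semidefinite matrix, hence in its kernel, so
    [s^T v = 0]. The inclusion of kernels turns into an inclusion of row spaces, which is then
    transposed. *)
Lemma psdmx_block_range (R : realType) n m (L : 'M[R]_n) (s : 'M[R]_(n, m)) G :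
  psdmx (block_mx L s s^T G) -> exists z, s = L *m z.
Proof.
move=> psB; have [sB _] := psB.
have sL : L^T = L.
  by move: sB; rewrite tr_block_mx => /eq_block_mx[].
have ker (v : 'cV_n) : L *m v = 0 -> s^T *m v = 0.
  move=> Lv; have := @psdmx_ker _ _ _ (col_mx v 0) psB.
  rewrite /qform -mulmxA mul_block_col !mulmx0 !addr0 Lv tr_col_mx mul_row_col.
  rewrite trmx0 mul0mx mulmx0 addr0 mxE => /(_ erefl) /(congr1 dsubmx).
  by rewrite col_mxKd linear0.
have : (s^T <= L)%MS.
  rewrite submxE; apply/eqP/matrixP => i j.
  have := ker (col j (cokermx L)); rewrite colE (mulmxA L) (mulmxA s^T) mulmx_coker mul0mx.
  by move=> /(_ erefl); rewrite -colE => /colP/(_ i); rewrite !mxE.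
case/submxP => D sE; exists D^T.
by rewrite -[LHS]trmxK sE trmx_mul sL.
Qed.

(** Completing the square: at [(u, c)] the form equals the form of [L] at [u + e c z] plus
    [c^2 (1 - e^2 z^T L z)]. *)
Lemma psdmx_block_small (R : realType) n (L : 'M[R]_n) (z : 'cV[R]_n) (e : R) :
  psdmx L -> e ^+ 2 * qform L z <= 1 ->
  psdmx (block_mx L (e *: (L *m z)) (e *: (L *m z))^T 1%:M).
Proof.
move=> [sL pL] le1; split=> [|v].
  by rewrite tr_block_mx sL trmxK trmx1.
rewrite -[v]vsubmxK; set u := usubmx v; set c := dsubmx v.
have cE : c = (c 0 0)%:M by apply: mx11_scalar.
have := pL (u + (e * c 0 0) *: z).
have -> : 0 <= ((col_mx u c)^T *m block_mx L (e *: (L *m z)) (e *: (L *m z))^T 1%:M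
   *m col_mx u c) 0 0 = (0 <= qform L (u + (e * c 0 0) *: z) +
     (c 0 0) ^+ 2 * (1 - e ^+ 2 * qform L z)).
  congr (0 <= _).
  have zLu : z^T *m L *m u = u^T *m L *m z.
    rewrite [LHS]mx11_scalar -tr_scalar_mx -mx11_scalar.
    by rewrite !trmx_mul trmxK sL mulmxA.
  have trE : (u + (e * c 0 0) *: z)^T = u^T + (e * c 0 0) *: z^T.
    by rewrite linearD linearZ.
  rewrite /qform trE !mulmxDl !mulmxDr -!scalemxAl -!scalemxAr zLu.
  rewrite tr_col_mx -mulmxA mul_block_col mul_row_col !mulmxDr mul1mx.
  rewrite linearZ /= trmx_mul sL [in LHS]cE tr_scalar_mx.
  rewrite !mul_scalar_mx !mul_mx_scalar -!scalemxAl -!scalemxAr zLu !mulmxA.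
  move: (u^T *m L *m u) (u^T *m L *m z) (z^T *m L *m z) (c 0 0) => A B C x.
  by rewrite !mxE /= mulr1n; ring.
move=> h; apply: addr_ge0 => //; apply: mulr_ge0; first exact: sqr_ge0.
by rewrite subr_ge0.
Qed.

Definition halfspaces (R : realType) (g d : nat) (F : 'I_d -> 'rV[R]_g.+1) : freeset R g :=
  fun n X => SM X /\ forall k, psdmx (affmx X (F k)).

Lemma free_spectrahedron_diag (R : realType) g d (C : mxtuple R g d) :
  (forall i, is_diag_mx (C i)) ->
  freeset_eq (free_spectrahedron C) (halfspaces (diag_form C)).
Proof.
by move=> dC n X; split=> -[sX] h; split=> //; apply/(psdmx_linpencil_diag dC sX).
Qed.

Lemma arveson_boundary_eq (R : realType) g (K L : freeset R g) n (X : mxtuple R g n) :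
  freeset_eq K L -> arveson_boundary K X <-> arveson_boundary L X.
Proof.
move=> KL; split=> -[hX h]; split; try exact/KL; move=> m beta gamma sg /KL.
  exact: h.
exact: h.
Qed.

Lemma SM_dilation (R : realType) g n m (X : mxtuple R g n)
    (beta : 'I_g -> 'M[R]_(n, m)) (gamma : mxtuple R g m) :
  SM X -> (forall i, (gamma i)^T = gamma i) -> SM (dilation X beta gamma).
Proof.
move=> [n0 sX] sg; split=> [|i]; first by rewrite addn_gt0 n0.
by rewrite tr_block_mx sX sg trmxK.
Qed.

(** A [beta] compatible with all ranges gives, once scaled down, an actual dilation with [m = 1] and
    [gamma = 0]; the normalisation [F k 0 0 = 1] makes every lower right block equal to 1. *)
Lemma arveson_halfspaces_necessary (R : realType) g d (F : 'I_d -> 'rV[R]_g.+1) n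
    (X : mxtuple R g n) (beta : 'I_g -> 'cV[R]_n) :
  (forall k, F k 0 0 = 1) -> arveson_boundary (halfspaces F) X ->
  (forall k, exists z, difmx beta (F k) = affmx X (F k) *m z) ->
  forall i, beta i = 0.
Proof.
move=> F1 [[sX pX] arv] /fin_all_exists [z zE].
pose c k := qform (affmx X (F k)) (z k).
have c0 k : 0 <= c k by have [_] := pX k; apply.
(* A single scale for all [k]: [e <= 1] and [e * c k <= 1], so [e ^+ 2 * c k <= 1]. *)
pose e := (1 + \sum_k c k)^-1.
have S0 : 0 <= \sum_k c k by apply: sumr_ge0.
have e0 : 0 < e by rewrite invr_gt0; lra.
have eE : (1 + \sum_k c k) * e = 1 by rewrite mulfV // gt_eqF //; lra.
have le1 k : e ^+ 2 * c k <= 1.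
  have : c k <= \sum_k c k by rewrite (bigD1 k) //= lerDl sumr_ge0.
  move=> h; nra.
suff h : forall i, e *: beta i = 0.
  by move=> i; have /eqP := h i; rewrite scaler_eq0 gt_eqF // => /eqP.
apply: (arv 1%N (fun i => e *: beta i) (fun=> 0)).
  by split=> // j; rewrite trmx0.
split; first by apply: SM_dilation => // j; rewrite trmx0.
move=> k; rewrite affmx_dilation difmxZ zE.
have -> : affmx (fun=> 0) (F k) = 1%:M :> 'M[R]_1.
  by rewrite /affmx F1 big1 ?addr0 // => j _; rewrite scaler0.
exact: psdmx_block_small (pX k) (le1 k).
Qed.

Lemma arveson_halfspaces_sufficient (R : realType) g d (F : 'I_d -> 'rV[R]_g.+1) n
    (X : mxtuple R g n) :
  halfspaces F X ->
  (forall m (beta : 'I_g -> 'M[R]_(n, m)),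
    (forall k, exists z, difmx beta (F k) = affmx X (F k) *m z) ->
    forall i, beta i = 0) ->
  arveson_boundary (halfspaces F) X.
Proof.
move=> hX h; split=> // m beta gamma _ [_ pY]; apply: h => k.
by have := pY k; rewrite affmx_dilation => /psdmx_block_range.
Qed.

Lemma mxrank_cap_ge (F : fieldType) m1 m2 n (A : 'M[F]_(m1, n)) (B : 'M[F]_(m2, n)) :
  (\rank A + \rank B <= \rank (A :&: B)%MS + n)%N.
Proof. by rewrite -mxrank_sum_cap addnC leq_add2l rank_leq_col. Qed.

(** * The rank criterion for four sides in the plane *)

Definition cx (R : realType) (f : 'rV[R]_3) : R := f 0 (lift 0 ord0).
Definition cy (R : realType) (f : 'rV[R]_3) : R := f 0 (lift 0 ord_max).
Definition detf (R : realType) (f h : 'rV[R]_3) : R := cx f * cy h - cy f * cx h.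

Lemma difmx2 (R : realType) n m (beta : 'I_2 -> 'M[R]_(n, m)) (f : 'rV[R]_3) :
  difmx beta f = cx f *: beta ord0 + cy f *: beta ord_max.
Proof.
rewrite /difmx !big_ord_recl big_ord0 addr0.
by have -> : lift ord0 ord0 = ord_max :> 'I_2 by apply: val_inj.
Qed.

(** The forms of the pencil have constant term 1 while those of a frame are normalised by their
    sums; semidefiniteness and ranges ignore the positive factors between them. *)
Definition rescaled (R : realType) d (F : 'I_d -> 'rV[R]_3) (s : seq 'rV[R]_3) :=
  (forall k, exists2 f, f \in s & exists2 c, 0 < c & F k = c *: f) /\
  (forall f, f \in s -> exists k, exists2 c, 0 < c & f = c *: F k).

Lemma rescaled_psd (R : realType) d (F : 'I_d -> 'rV[R]_3) s n (X : mxtuple R 2 n) :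
  rescaled F s -> (forall k, psdmx (affmx X (F k))) ->
  forall f, f \in s -> psdmx (affmx X f).
Proof.
move=> [_ h] pX f /h [k [c c0 ->]]; rewrite linearZ.
exact: psdmxZ (ltW c0) (pX k).
Qed.

Lemma rescaled_solve (R : realType) d (F : 'I_d -> 'rV[R]_3) s n m (X : mxtuple R 2 n)
    (beta : 'I_2 -> 'M[R]_(n, m)) :
  rescaled F s -> (forall k, exists z, difmx beta (F k) = affmx X (F k) *m z) <->
  (forall f, f \in s -> exists z, difmx beta f = affmx X f *m z).
Proof.
move=> [h1 h2]; split=> [h f /h2 [k [c c0 ->]]|h k].
  by have [z zE] := h k; exists z; rewrite !linearZ /= zE scalemxAl.
have [f fs [c c0 ->]] := h1 k; have [z zE] := h f fs; exists z.
by rewrite !linearZ /= zE scalemxAl.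
Qed.

(** Being in the row space of [L] amounts to [n - rank L] linear equations, given by the cokernel,
    on a pair of rows, that is, on a space of dimension [2n]. *)
Lemma solve_range_dim (R : realType) n (L : 'M[R]_n) (x y : R) :
  exists2 V : 'M[R]_(n + n), (n + \rank L <= \rank V)%N &
    forall u : 'rV_(n + n), (u <= V)%MS ->
      exists z, x *: lsubmx u + y *: rsubmx u = z *m L.
Proof.
pose G : 'M_(n + n, n) := col_mx x%:M y%:M *m cokermx L.
exists (kermx G) => [|u /sub_kermxP].
  have := mxrankM_maxr (col_mx x%:M y%:M) (cokermx L).
  rewrite mxrank_ker mxrank_coker -/G; have := rank_leq_row L; lia.
rewrite -{1}[u]hsubmxK /G mulmxA mul_row_col !mul_mx_scalar => /eqP.
by rewrite -submxE => /submxP [z ->]; exists z.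
Qed.

(** Four subspaces of dimensions at least [n + r_i] in a space of dimension [2n] meet in dimension
    at least [r1 + r2 + r3 + r4 - 2n]. Each opposite pair of ranks already sums to at least [n], so
    an excess in one pair produces a nonzero [beta]. *)
Lemma arveson_quad_rank (R : realType) d (F : 'I_d -> 'rV[R]_3) n (X : mxtuple R 2 n)
    (f1 f2 f3 f4 : 'rV[R]_3) (a b c : R) :
  (forall k, F k 0 0 = 1) -> rescaled F [:: f1; f2; f3; f4] ->
  quad_frame (delta_mx 0 0) f1 f2 f3 f4 a b c ->
  arveson_boundary (halfspaces F) X ->
  (\rank (affmx X f1) + \rank (affmx X f3) <= n)%N /\
  (\rank (affmx X f2) + \rank (affmx X f4) <= n)%N.
Proof.
move=> F1 Ff Q arv; have [[sX pX] _] := arv.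
have pf := rescaled_psd Ff pX.
have := quad_frame_linear (affmx X) Q; rewrite /= affmx_delta0 => QX.
have pM : posdefmx (affmx X f1 + affmx X f3).
  by apply: (quad_frame_posdef QX); apply: pf; rewrite !inE eqxx ?orbT.
have r13 := mxrank_unit_add pM.2.
have r24 : (n <= \rank (affmx X f2) + \rank (affmx X f4))%N.
  by apply: mxrank_unit_add; rewrite -(quad_frame_sum QX) pM.2.
apply/andP; apply: contraT => big.
have [V1 d1 s1] := solve_range_dim (affmx X f1) (cx f1) (cy f1).
have [V2 d2 s2] := solve_range_dim (affmx X f2) (cx f2) (cy f2).
have [V3 d3 s3] := solve_range_dim (affmx X f3) (cx f3) (cy f3).
have [V4 d4 s4] := solve_range_dim (affmx X f4) (cx f4) (cy f4).
pose V := ((V1 :&: V2) :&: (V3 :&: V4))%MS.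
have V0 : nz_row V != 0.
  rewrite nz_row_eq0 -mxrank_eq0 -lt0n.
  have := mxrank_cap_ge (V1 :&: V2)%MS (V3 :&: V4)%MS.
  have := mxrank_cap_ge V1 V2; have := mxrank_cap_ge V3 V4.
  rewrite -/V; move: big; rewrite negb_and -!ltnNge; lia.
have := nz_row_sub V; set u := nz_row V in V0 *.
rewrite !sub_capmx => /andP[/andP[u1 u2] /andP[u3 u4]].
pose beta (i : 'I_2) : 'cV_n := if i == ord0 then (lsubmx u)^T else (rsubmx u)^T.
have solve f z : cx f *: lsubmx u + cy f *: rsubmx u = z *m affmx X f ->
    exists w, difmx beta f = affmx X f *m w.
  move=> h; exists z^T; rewrite difmx2 /beta /=.
  by rewrite -[affmx X f](affmx_tr f sX) -trmx_mul -h linearD !linearZ.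
have beta0 : forall i, beta i = 0.
  apply: (arveson_halfspaces_necessary F1 arv).
  apply/(rescaled_solve _ _ Ff) => f; rewrite !inE => /or4P[] /eqP->.
  - by have [z /solve] := s1 u u1.
  - by have [z /solve] := s2 u u2.
  - by have [z /solve] := s3 u u3.
  - by have [z /solve] := s4 u u4.
case/negP: V0; rewrite -[u]hsubmxK.
have := beta0 ord0; have := beta0 ord_max; rewrite /beta /=.
move=> /(congr1 trmx) + /(congr1 trmx); rewrite !trmxK !trmx0 => -> ->.
by rewrite row_mx0.
Qed.

Lemma quad_rank_arveson (R : realType) d (F : 'I_d -> 'rV[R]_3) n (X : mxtuple R 2 n)
    (f1 f2 f3 f4 : 'rV[R]_3) (a b c : R) :
  rescaled F [:: f1; f2; f3; f4] ->
  quad_frame (delta_mx 0 0) f1 f2 f3 f4 a b c ->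
  detf f1 f2 != 0 -> halfspaces F X ->
  (\rank (affmx X f1) + \rank (affmx X f3) <= n)%N ->
  (\rank (affmx X f2) + \rank (affmx X f4) <= n)%N ->
  arveson_boundary (halfspaces F) X.
Proof.
move=> Ff Q det0 hX r13 r24; have [sX pX] := hX.
have pf := rescaled_psd Ff pX.
have := quad_frame_linear (affmx X) Q; rewrite /= affmx_delta0 => QX.
apply: arveson_halfspaces_sufficient => // m beta /(rescaled_solve _ _ Ff) h.
have := quad_frame_linear (difmx beta) Q; rewrite /= difmx_delta0.
have [|z1 e1] := h f1; first by rewrite !inE eqxx ?orbT.
have [|z2 e2] := h f2; first by rewrite !inE eqxx ?orbT.
have [|z3 e3] := h f3; first by rewrite !inE eqxx ?orbT.
have [|z4 e4] := h f4; first by rewrite !inE eqxx ?orbT.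
rewrite /= e1 e2 e3 e4 => Qb.
have [] := quad_frame_rigid QX _ _ _ _ r13 r24 Qb;
  try by apply: pf; rewrite !inE eqxx ?orbT.
rewrite -e1 -e2 !difmx2.
set B0 := beta ord0; set B1 := beta ord_max => h1 h2.
(* Cramer's rule: sides 1 and 2 are not parallel, so their two combinations determine both
   components of [beta]. *)
have B00 : B0 = 0.
  have : detf f1 f2 *: B0 =
      cy f2 *: (cx f1 *: B0 + cy f1 *: B1) - cy f1 *: (cx f2 *: B0 + cy f2 *: B1).
    by apply/matrixP => i j; rewrite !mxE /detf; ring.
  by rewrite h1 h2 !scaler0 subr0 => /eqP; rewrite scaler_eq0 (negbTE det0) => /eqP.
have B10 : B1 = 0.
  have : detf f1 f2 *: B1 =
      cx f1 *: (cx f2 *: B0 + cy f2 *: B1) - cx f2 *: (cx f1 *: B0 + cy f1 *: B1).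
    by apply/matrixP => i j; rewrite !mxE /detf; ring.
  by rewrite h1 h2 !scaler0 subr0 => /eqP; rewrite scaler_eq0 (negbTE det0) => /eqP.
move=> i; have [->|i0] := eqVneq i ord0; first by [].
have -> : i = ord_max by apply: val_inj; case: i i0 => [[|[|]]].
by [].
Qed.

(** * Noncommutative polynomials *)

Lemma nceval_fset (R : realType) g n (X : mxtuple R g n) (p : ncpoly R g)
    (D : {fset {fmonom 'I_g}}) : (msupp p `<=` D)%fset ->
  nceval p X = \sum_(w <- D) p@_w *: \prod_(i <- (w : seq 'I_g)) X i.
Proof.
move=> le; rewrite [LHS](big_fset_incl _ le) => //= w _ /mcoeff_outdom ->.
by rewrite scale0r.
Qed.

Lemma ncevalD (R : realType) g n (X : mxtuple R g n) :
  {morph (fun p => nceval p X) : p q / p + q}.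
Proof.
move=> p q /=; rewrite (nceval_fset X (msuppD_le p q)).
rewrite (nceval_fset X (fsubsetUl (msupp p) (msupp q))).
rewrite (nceval_fset X (fsubsetUr (msupp p) (msupp q))) -big_split.
by apply: eq_bigr => w _ /=; rewrite mcoeffD scalerDl.
Qed.

Lemma nceval0 (R : realType) g n (X : mxtuple R g n) : nceval 0 X = 0.
Proof. by rewrite /nceval msupp0 big_seq_fset0. Qed.

Lemma ncevalU (R : realType) g n (X : mxtuple R g n) (c : R) (w : {fmonom 'I_g}) :
  nceval << c *g w >> X = c *: \prod_(i <- (w : seq 'I_g)) X i.
Proof. by rewrite (nceval_fset X msuppU_le) big_seq_fset1 mcoeffUU. Qed.

Lemma nceval_sum (R : realType) g n (X : mxtuple R g n) (I : Type) (s : seq I)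
    (p : I -> ncpoly R g) :
  nceval (\sum_(i <- s) p i) X = \sum_(i <- s) nceval (p i) X.
Proof. exact: (big_morph (fun q => nceval q X) (ncevalD X) (nceval0 X)). Qed.

Lemma ncevalM (R : realType) g n (X : mxtuple R g n) (p q : ncpoly R g) :
  nceval (p * q) X = nceval p X *m nceval q X.
Proof.
rewrite malgME nceval_sum [nceval p X in RHS]/nceval mulmx_suml.
apply: eq_bigr => v _; rewrite nceval_sum [nceval q X in RHS]/nceval mulmx_sumr.
apply: eq_bigr => w _; rewrite ncevalU -scalemxAl -scalemxAr scalerA.
by rewrite fmM big_cat.
Qed.

Lemma ncdeg_leD (R : realType) g (p q : ncpoly R g) k :
  ncdeg_le p k -> ncdeg_le q k -> ncdeg_le (p + q) k.
Proof.
move=> hp hq w /(fsubsetP (msuppD_le p q)); rewrite in_fsetU.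
by case/orP; [apply: hp|apply: hq].
Qed.

Lemma ncdeg_le0 (R : realType) g k : ncdeg_le (0 : ncpoly R g) k.
Proof. by move=> w; rewrite msupp0. Qed.

Lemma ncdeg_leU (R : realType) g (c : R) (w : {fmonom 'I_g}) k :
  (fdeg w <= k)%N -> ncdeg_le << c *g w >> k.
Proof. by move=> wk v /(fsubsetP msuppU_le); rewrite in_fset1 => /eqP->. Qed.

Lemma ncdeg_leM (R : realType) g (p q : ncpoly R g) j k :
  ncdeg_le p j -> ncdeg_le q k -> ncdeg_le (p * q) (j + k).
Proof.
move=> hp hq w /msuppM_le [v [u [vp uq ->]]]; rewrite fdegM.
by apply: leq_add; [apply: hp|apply: hq].
Qed.

Definition affpoly (R : realType) g (f : 'rV[R]_g.+1) : ncpoly R g :=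
  << f 0 0 *g mone >> + \sum_(i < g) << f 0 (lift 0 i) *g fmu i >>.

Lemma nceval_affpoly (R : realType) g n (X : mxtuple R g n) (f : 'rV[R]_g.+1) :
  nceval (affpoly f) X = affmx X f.
Proof.
rewrite /affpoly ncevalD ncevalU fm1 big_nil scalemx1 nceval_sum; congr (_ + _).
by apply: eq_bigr => i _; rewrite ncevalU fmU big_seq1.
Qed.

Lemma ncdeg_le_affpoly (R : realType) g (f : 'rV[R]_g.+1) : ncdeg_le (affpoly f) 1.
Proof.
apply: ncdeg_leD; first by apply: ncdeg_leU; rewrite fdeg1.
apply: (big_ind (fun p => ncdeg_le p 1)); first exact: ncdeg_le0.
  by move=> p q; apply: ncdeg_leD.
by move=> i _; apply: ncdeg_leU; rewrite fdegU.
Qed.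

(** * Plane quadrilaterals *)

Definition afev (R : realType) (f : 'rV[R]_3) (p : 'rV[R]_2) : R :=
  f 0 0 + cx f * p 0 ord0 + cy f * p 0 ord_max.

Lemma afevD (R : realType) (f h : 'rV[R]_3) p : afev (f + h) p = afev f p + afev h p.
Proof. by rewrite /afev /cx /cy !mxE; ring. Qed.

Lemma afevZ (R : realType) (c : R) (f : 'rV[R]_3) p : afev (c *: f) p = c * afev f p.
Proof. by rewrite /afev /cx /cy !mxE; ring. Qed.

Lemma afevB (R : realType) (f h : 'rV[R]_3) p : afev (f - h) p = afev f p - afev h p.
Proof. by rewrite /afev /cx /cy !mxE; ring. Qed.

Lemma afev_delta0 (R : realType) (p : 'rV[R]_2) : afev (delta_mx 0 0) p = 1.
Proof. by rewrite /afev /cx /cy !mxE /=; ring. Qed.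

Lemma ord2P (i : 'I_2) : i = ord0 \/ i = ord_max.
Proof.
by case: i => [[|[|//]]] h; [left|right]; apply: val_inj.
Qed.

Lemma row2P (R : realType) (p q : 'rV[R]_2) :
  p 0 ord0 = q 0 ord0 -> p 0 ord_max = q 0 ord_max -> p = q.
Proof. by move=> h0 h1; apply/rowP => i; case: (ord2P i) => ->. Qed.

Lemma row3_eq0 (R : realType) (f : 'rV[R]_3) : f 0 0 = 0 -> cx f = 0 -> cy f = 0 -> f = 0.
Proof.
move=> h0 h1 h2; apply/rowP => i; rewrite mxE.
case: (unliftP 0 i) => [j|] -> //.
by case: (ord2P j) => ->.
Qed.

Lemma level1_halfspaces (R : realType) d (F : 'I_d -> 'rV[R]_3) (p : 'rV[R]_2) :
  level1 (halfspaces F) p <-> forall k, 0 <= afev (F k) p.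
Proof.
have E f : affmx (fun i => (p 0 i)%:M : 'M[R]_1) f = (afev f p)%:M.
  rewrite /affmx -/(difmx (fun i => (p 0 i)%:M : 'M[R]_1) f) difmx2.
  by apply/matrixP => i j; rewrite !ord1 !mxE /= !mulr1n /afev; ring.
have psdE (c : R) : psdmx (c%:M : 'M[R]_1) <-> 0 <= c.
  split=> [[_ /(_ 1%:M)]|c0]; first by rewrite trmx1 mul1mx mulmx1 mxE.
  split=> [|v]; first by rewrite tr_scalar_mx.
  by rewrite mul_mx_scalar -scalemxAl mxE mulr_ge0 // sqnorm_ge0.
split=> [[_ h] k|h]; first by apply/psdE; rewrite -E; apply: h.
split; first by split=> // i; rewrite tr_scalar_mx.
by move=> k; rewrite E; apply/psdE.
Qed.

(** The product of the two determinants is the determinant of the values of [f] and [h] along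
    [q - p] and [r - p], and that matrix is diagonal. So the sides are not parallel and the three
    corners are not collinear. *)
Lemma det_neq0_of_points (R : realType) (f h : 'rV[R]_3) (p q r : 'rV[R]_2) :
  afev f p = 0 -> afev h p = 0 -> afev f q != 0 -> afev h q = 0 ->
  afev f r = 0 -> afev h r != 0 ->
  detf f h *
  ((q 0 ord0 - p 0 ord0) * (r 0 ord_max - p 0 ord_max) -
   (q 0 ord_max - p 0 ord_max) * (r 0 ord0 - p 0 ord0)) != 0.
Proof.
move=> fp hp fq hq fr hr.
rewrite (_ : _ * _ = afev f q * afev h r) ?mulf_neq0 //.
rewrite -[afev f q]subr0 -[afev h r]subr0 -{1}fp -{1}hp.
transitivity ((afev f q - afev f p) * (afev h r - afev h p) -
  (afev f r - afev f p) * (afev h q - afev h p)); first by rewrite /afev /detf; ring.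
by rewrite fp hp fr hq; ring.
Qed.

Lemma afev_eq0_of_points (R : realType) (g : 'rV[R]_3) (p q r : 'rV[R]_2) :
  (q 0 ord0 - p 0 ord0) * (r 0 ord_max - p 0 ord_max) -
   (q 0 ord_max - p 0 ord_max) * (r 0 ord0 - p 0 ord0) != 0 ->
  afev g p = 0 -> afev g q = 0 -> afev g r = 0 -> g = 0.
Proof.
set D := _ - _ => D0 gp gq gr.
have gx : cx g = 0.
  apply: (mulIf D0); rewrite mul0r.
  transitivity ((afev g q - afev g p) * (r 0 ord_max - p 0 ord_max) -
    (afev g r - afev g p) * (q 0 ord_max - p 0 ord_max)); first by rewrite /afev /D; ring.
  by rewrite gp gq gr; ring.
have gy : cy g = 0.
  apply: (mulIf D0); rewrite mul0r.
  transitivity ((afev g r - afev g p) * (q 0 ord0 - p 0 ord0) -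
    (afev g q - afev g p) * (r 0 ord0 - p 0 ord0)); first by rewrite /afev /D; ring.
  by rewrite gp gq gr; ring.
by apply: row3_eq0 => //; move: gp; rewrite /afev gx gy !mul0r !addr0.
Qed.

(** An affine identity may be checked at the noncollinear corners [p12], [p23], [p41]. At each of
    them two forms vanish, so the scalings are fixed one ratio at a time, starting from [m = 1] at
    [p12], whence [d = 1]. The values of [m] at [p23] and [p41] give [a] and [b]; the fourth corner
    gives [a + b + 1 > 0]. *)
Lemma quad_frame_exists (R : realType) (l1 l2 l3 l4 : 'rV[R]_3)
    (p12 p23 p34 p41 : 'rV[R]_2) :
  afev l1 p12 = 0 -> afev l2 p12 = 0 -> 0 < afev l3 p12 -> 0 < afev l4 p12 ->
  afev l2 p23 = 0 -> afev l3 p23 = 0 -> 0 < afev l4 p23 -> 0 < afev l1 p23 ->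
  afev l3 p34 = 0 -> afev l4 p34 = 0 -> 0 < afev l1 p34 -> 0 < afev l2 p34 ->
  afev l4 p41 = 0 -> afev l1 p41 = 0 -> 0 < afev l2 p41 -> 0 < afev l3 p41 ->
  exists c1 c2 c3 c4 a b d : R,
    [/\ [/\ 0 < c1, 0 < c2, 0 < c3 & 0 < c4], detf l1 l2 != 0 &
      quad_frame (delta_mx 0 0) (c1 *: l1) (c2 *: l2) (c3 *: l3) (c4 *: l4) a b d].
Proof.
move=> z1 z2 p3 p4 y2 y3 q4 q1 x3 x4 r1 r2 w4 w1 s2 s3.
have D := det_neq0_of_points z1 z2 (lt0r_neq0 q1) y2 w1 (lt0r_neq0 s2).
have := D; rewrite mulf_eq0 negb_or => /andP[dn dp].
have interp g := afev_eq0_of_points (g := g) dp.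
pose c3 := (afev l3 p12)^-1; pose c4 := (afev l4 p12)^-1.
pose c1 := c4 * afev l4 p23 / afev l1 p23.
pose c2 := c3 * afev l3 p41 / afev l2 p41.
have c3p : 0 < c3 by rewrite invr_gt0.
have c4p : 0 < c4 by rewrite invr_gt0.
have c1p : 0 < c1 by rewrite !mulr_gt0 // invr_gt0.
have c2p : 0 < c2 by rewrite !mulr_gt0 // invr_gt0.
have S : c1 *: l1 + c3 *: l3 = c2 *: l2 + c4 *: l4.
  apply/eqP; rewrite -subr_eq0; apply/eqP; apply: interp;
    rewrite afevB !afevD !afevZ ?z1 ?z2 ?y2 ?y3 ?w4 ?w1 ?mulr0 ?add0r ?addr0.
  - by rewrite /c3 /c4 !mulVf ?lt0r_neq0 // subrr.
  - by rewrite /c1 divfK ?lt0r_neq0 // subrr.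
  - by rewrite /c2 divfK ?lt0r_neq0 // subrr.
pose m := c1 *: l1 + c3 *: l3.
have m12 : afev m p12 = 1 by rewrite afevD !afevZ z1 mulr0 add0r mulVf ?lt0r_neq0.
have m23 : afev m p23 = c1 * afev l1 p23 by rewrite afevD !afevZ y3 mulr0 addr0.
have m41 : afev m p41 = c2 * afev l2 p41.
  by rewrite /m S afevD !afevZ w4 mulr0 addr0.
have m34 : afev m p34 = c1 * afev l1 p34 by rewrite afevD !afevZ x3 mulr0 addr0.
have m34' : afev m p34 = c2 * afev l2 p34.
  by rewrite /m S afevD !afevZ x4 mulr0 addr0.
have u23 : 0 < c1 * afev l1 p23 by rewrite mulr_gt0.
have u41 : 0 < c2 * afev l2 p41 by rewrite mulr_gt0.
have u34 : 0 < c1 * afev l1 p34 by rewrite mulr_gt0.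
pose a := (c1 * afev l1 p23)^-1 - 1; pose b := (c2 * afev l2 p41)^-1 - 1.
have E : delta_mx 0 0 = a *: (c1 *: l1) + b *: (c2 *: l2) + 1 *: m.
  apply/eqP; rewrite -subr_eq0; apply/eqP; apply: interp;
    rewrite afevB (afevD _ (1 *: m)) (afevD (a *: _)) !afevZ afev_delta0.
  - by rewrite z1 z2 m12; ring.
  - by rewrite y2 m23 /a mulrBl mulVf ?lt0r_neq0 //; ring.
  - by rewrite w1 m41 /b [_ * (c2 * _)]mulrBl mulVf ?lt0r_neq0 //; ring.
exists c1, c2, c3, c4, a, b, 1; split=> //; split=> //; split=> //.
- by rewrite /a subrK invr_gt0.
- by rewrite /b subrK invr_gt0.
- have : afev (delta_mx 0 0) p34 = (a + b + 1) * afev m p34.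
    by rewrite E (afevD _ (1 *: m)) (afevD (a *: _)) !afevZ -m34 -m34'; ring.
  rewrite afev_delta0 => h; rewrite -m34 in u34.
  by rewrite -(pmulr_lgt0 _ u34) -h ltr01.
Qed.

(** * Corners and the sides through them *)

Lemma conv_hull_weight1 (R : realType) m n (v : 'I_n.+1 -> 'rV[R]_m) (r : 'I_n.+1 -> R) j :
  ~ conv_hull (fun i => v (lift j i)) (v j) ->
  (forall i, 0 <= r i) -> \sum_i r i = 1 -> v j = \sum_i r i *: v i -> r j = 1.
Proof.
move=> out r0 r1 vE; apply/eqP; apply: contra_notT out => rj.
have S : \sum_i r (lift j i) = 1 - r j by rewrite -r1 (bigD1_ord j) //= addrAC subrr add0r.
have rj1 : 0 < 1 - r j.
  by rewrite lt_neqAle eq_sym subr_eq0 eq_sym rj -S sumr_ge0.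
have u := lt0r_neq0 rj1.
exists (fun i => (1 - r j)^-1 * r (lift j i)); split=> [i||].
- by rewrite mulr_ge0 // invr_ge0 ltW.
- by rewrite -mulr_sumr S mulVf.
- have : (1 - r j) *: v j = \sum_i r (lift j i) *: v (lift j i).
    by rewrite scalerBl scale1r {1}vE (bigD1_ord j) //= addrAC subrr add0r.
  move=> /(congr1 (fun x => (1 - r j)^-1 *: x)); rewrite scalerA mulVf // scale1r => ->.
  by rewrite scaler_sumr; apply: eq_bigr => i _; rewrite scalerA.
Qed.

(** The indices may coincide, the weights then being added; degenerate segments are used below to
    prove that the corners are distinct. *)
Lemma sum_two (R : realType) (V : lmodType R) n (i k : 'I_n) (x y : R) (v : 'I_n -> V) :
  \sum_j ((j == i)%:R * x + (j == k)%:R * y) *: v j = x *: v i + y *: v k.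
Proof.
under eq_bigr => j _ do rewrite scalerDl.
rewrite big_split /= (bigD1 i) //= big1 => [|j ji]; last by rewrite (negbTE ji) mul0r scale0r.
rewrite (bigD1 k) //= big1 => [|j jk]; last by rewrite (negbTE jk) mul0r scale0r.
by rewrite !eqxx !mul1r !addr0.
Qed.

Lemma conv_hull_no_segment (R : realType) m n (v : 'I_n.+1 -> 'rV[R]_m) (x y : R) i j k :
  ~ conv_hull (fun i => v (lift j i)) (v j) -> j != i -> j != k ->
  0 <= x -> 0 <= y -> x + y = 1 -> v j <> x *: v i + y *: v k.
Proof.
move=> out ji jk x0 y0 xy vE.
pose r l := (l == i)%:R * x + (l == k)%:R * y.
have : r j = 1.
  apply: (conv_hull_weight1 out) => [l||]; last by rewrite sum_two.
    by rewrite addr_ge0 // mulr_ge0.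
  rewrite -xy -[x in RHS]mulr1 -[y in RHS]mulr1.
  have := @sum_two R R^o n.+1 i k x y (fun=> 1) => <-.
  by apply: eq_bigr => l _; rewrite -[RHS]/(_ * _) mulr1.
rewrite /r (negbTE ji) (negbTE jk) !mul0r addr0 => /eqP.
by rewrite eq_sym oner_eq0.
Qed.

Definition extreme_points (R : realType) m n (v : 'I_n.+1 -> 'rV[R]_m) :=
  forall i, ~ conv_hull (fun j => v (lift i j)) (v i).

Lemma extreme_points_inj (R : realType) m n (v : 'I_n.+1 -> 'rV[R]_m) :
  extreme_points v -> injective v.
Proof.
move=> out i j vE; apply/eqP; apply: contraT => ij.
case: (@conv_hull_no_segment _ _ _ v 1 0 j i j (out i)) => //; first by rewrite addr0.
by rewrite scale1r scale0r addr0.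
Qed.

Lemma extreme_points_not_collinear (R : realType) n (v : 'I_n.+1 -> 'rV[R]_2)
    (f : 'rV[R]_3) i j k :
  extreme_points v -> f 0 0 = 1 ->
  afev f (v i) = 0 -> afev f (v j) = 0 -> afev f (v k) = 0 ->
  i != j -> j != k -> i != k -> False.
Proof.
move=> out f1.
(* [s] is a coordinate along the line [f = 0], and [q] is the squared length of the gradient of [f].
   On the line, [q * p] is affine in [s], so the middle one of three values of [s] belongs to a
   point on the segment between the other two. *)
pose s (p : 'rV[R]_2) := cx f * p 0 ord_max - cy f * p 0 ord0.
pose q := cx f ^+ 2 + cy f ^+ 2.
have q0 p : afev f p = 0 -> q != 0.
  move=> fp; rewrite /q paddr_eq0 ?sqr_ge0 // !sqrf_eq0.
  apply/negP => /andP[/eqP hx /eqP hy]; move: fp.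
  by rewrite /afev f1 hx hy !mul0r !addr0 => /eqP; rewrite oner_eq0.
have xE p : afev f p = 0 -> q * p 0 ord0 = - cx f - cy f * s p.
  move=> fp; have -> : q * p 0 ord0 = - cx f - cy f * s p + cx f * afev f p.
    by rewrite /q /s /afev f1; ring.
  by rewrite fp mulr0 addr0.
have yE p : afev f p = 0 -> q * p 0 ord_max = - cy f + cx f * s p.
  move=> fp; have -> : q * p 0 ord_max = - cy f + cx f * s p + cy f * afev f p.
    by rewrite /q /s /afev f1; ring.
  by rewrite fp mulr0 addr0.
have between a b c : afev f (v a) = 0 -> afev f (v b) = 0 -> afev f (v c) = 0 ->
    s (v a) < s (v b) -> s (v b) < s (v c) -> False.
  move=> fa fb fc ab bc.
  have ba : b != a by apply: contraTneq ab => ->; rewrite ltxx.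
  have bc' : b != c by apply: contraTneq bc => ->; rewrite ltxx.
  pose D := s (v c) - s (v a).
  have D0 : 0 < D by rewrite subr_gt0 (lt_trans ab).
  pose x := (s (v c) - s (v b)) / D; pose y := (s (v b) - s (v a)) / D.
  have x0 : 0 <= x by rewrite divr_ge0 ?ltW // subr_gt0.
  have y0 : 0 <= y by rewrite divr_ge0 ?ltW // subr_gt0.
  have xy : x + y = 1.
    by rewrite /x /y -mulrDl -(mulfV (lt0r_neq0 D0)) /D; congr (_ / _); ring.
  have sE : s (v b) = x * s (v a) + y * s (v c).
    have xD : x * D = s (v c) - s (v b) by rewrite divfK ?lt0r_neq0.
    have yD : y * D = s (v b) - s (v a) by rewrite divfK ?lt0r_neq0.
    apply: (mulIf (lt0r_neq0 D0)).
    transitivity (x * D * s (v a) + y * D * s (v c)); last by ring.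
    by rewrite xD yD /D; ring.
  apply: (conv_hull_no_segment (out b) ba bc' x0 y0 xy).
  have xE' : x = 1 - y by rewrite -xy addrK.
  apply: row2P; rewrite !mxE; apply: (mulfI (q0 _ fb)).
    by rewrite mulrDr ![q * (_ * _)]mulrCA !xE // sE xE'; ring.
  by rewrite mulrDr ![q * (_ * _)]mulrCA !yE // sE xE'; ring.
have sinj a b : afev f (v a) = 0 -> afev f (v b) = 0 -> s (v a) = s (v b) -> a = b.
  move=> fa fb sab; apply: (extreme_points_inj out).
  by apply: row2P; apply: (mulfI (q0 _ fb)); rewrite ?xE ?yE // sab.
move=> fi fj fk ij jk ik.
have := between i j k fi fj fk; have := between i k j fi fk fj.
have := between j i k fj fi fk; have := between j k i fj fk fi.
have := between k i j fk fi fj; have := between k j i fk fj fi.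
have [ab|ab|/sinj ab] := ltgtP (s (v i)) (s (v j)); last by rewrite ab ?eqxx in ij.
  have [bc|bc|/sinj bc] := ltgtP (s (v j)) (s (v k)); last by rewrite bc ?eqxx in jk.
    by auto.
  have [ac|ac|/sinj ac] := ltgtP (s (v i)) (s (v k)); last by rewrite ac ?eqxx in ik.
    by auto.
  by auto.
have [bc|bc|/sinj bc] := ltgtP (s (v j)) (s (v k)); last by rewrite bc ?eqxx in jk.
  have [ac|ac|/sinj ac] := ltgtP (s (v i)) (s (v k)); last by rewrite ac ?eqxx in ik.
    by auto.
  by auto.
by auto.
Qed.

Lemma afev_common_zero (R : realType) (f h : 'rV[R]_3) (p q : 'rV[R]_2) :
  detf f h != 0 -> afev f p = 0 -> afev h p = 0 -> afev f q = 0 -> afev h q = 0 -> p = q.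
Proof.
move=> D fp hp fq hq; apply: row2P; apply: (mulfI D); apply/eqP; rewrite -subr_eq0.
  suff -> : detf f h * p 0 ord0 - detf f h * q 0 ord0 =
      cy h * (afev f p - afev f q) - cy f * (afev h p - afev h q).
    by rewrite fp hp fq hq !subrr !mulr0 subrr.
  by rewrite /detf /afev; ring.
suff -> : detf f h * p 0 ord_max - detf f h * q 0 ord_max =
    cx f * (afev h p - afev h q) - cx h * (afev f p - afev f q).
  by rewrite fp hp fq hq !subrr !mulr0 subrr.
by rewrite /detf /afev; ring.
Qed.

(* Otherwise the vertex could be moved both ways along some direction [u]. *)
Lemma extreme_point_active_pair (R : realType) n d (v : 'I_n.+1 -> 'rV[R]_2)
    (F : 'I_d -> 'rV[R]_3) j :
  extreme_points v -> (forall k, F k 0 0 = 1) ->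
  (forall p, (forall k, 0 <= afev (F k) p) <-> conv_hull v p) ->
  exists k l, [/\ afev (F k) (v j) = 0, afev (F l) (v j) = 0 & detf (F k) (F l) != 0].
Proof.
move=> out F1 Q.
have inQ : conv_hull v (v j).
  exists (fun i => (i == j)%:R * 1 + (i == j)%:R * 0); split=> [i||].
  - by rewrite mulr0 addr0 mulr1.
  - rewrite (bigD1 j) //= big1 => [|i ij]; first by rewrite eqxx mulr1 mulr0 !addr0.
    by rewrite (negbTE ij) !mul0r addr0.
  - by rewrite sum_two scale1r scale0r addr0.
have pos := (Q (v j)).2 inQ.
have [/existsP[k /existsP[l /and3P[/eqP hk /eqP hl D]]]|none] :=
    boolP [exists k, [exists l, [&& afev (F k) (v j) == 0, afev (F l) (v j) == 0 &
      detf (F k) (F l) != 0]]]; first by exists k, l.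
exfalso.
(* If some form is active, all active ones are parallel to it and [u] runs along its zero line;
   otherwise any direction will do. *)
have dir : exists2 u : 'rV[R]_2, u != 0 & forall k, afev (F k) (v j) = 0 ->
    cx (F k) * u 0 ord0 + cy (F k) * u 0 ord_max = 0.
  have [/existsP[k /eqP hk]|none0] := boolP [exists k, afev (F k) (v j) == 0].
    exists (\row_i (if i == ord0 then - cy (F k) else cx (F k))).
      apply/eqP => u0; have := congr1 (fun u : 'rV[R]_2 => u 0 ord0) u0.
      have := congr1 (fun u : 'rV[R]_2 => u 0 ord_max) u0; rewrite !mxE /= => cx0 /eqP.
      rewrite oppr_eq0 => /eqP cy0; move: hk; rewrite /afev F1 cx0 cy0 !mul0r !addr0.
      by move/eqP; rewrite oner_eq0.
    move=> l hl; rewrite !mxE /=; apply/eqP; apply: contraT => D.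
    case/existsP: none; exists k; apply/existsP; exists l.
    rewrite hk hl !eqxx /=; apply: contraNneq D => D; apply/eqP.
    by rewrite -[RHS]D /detf; ring.
  exists (const_mx 1) => [|k hk].
    by apply/eqP => /rowP/(_ ord0)/eqP; rewrite !mxE oner_eq0.
  by case/existsP: none0; exists k; rewrite hk.
case: dir => u u0 hu.
pose m k := cx (F k) * u 0 ord0 + cy (F k) * u 0 ord_max.
pose c k := afev (F k) (v j).
(* Active forms contribute 0 to this sum, as division by 0 gives 0; they do not restrict the step,
   since [m k = 0] for them. *)
pose S := \sum_k `|m k| / c k.
have S0 : 0 <= S by apply: sumr_ge0 => k _; exact: divr_ge0 (normr_ge0 _) (pos k).
pose e := (1 + S)^-1.
have e0 : 0 < e by rewrite invr_gt0; lra.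
have eS : e * S <= 1.
  have : (1 + S) * e = 1 by rewrite mulfV // gt_eqF //; lra.
  move=> h; nra.
have small k : e * `|m k| <= c k.
  have [ck|ck] := eqVneq (c k) 0; first by rewrite /m hu // normr0 mulr0 ck.
  have ck0 : 0 < c k by rewrite lt_neqAle eq_sym ck pos.
  have : `|m k| / c k <= S.
    by rewrite /S (bigD1 k) //= lerDl sumr_ge0 // => i _; exact: divr_ge0 (normr_ge0 _) (pos i).
  rewrite -(ler_pM2l e0) => /le_trans/(_ eS).
  by rewrite mulrA ler_pdivrMr // mul1r.
have move_in t : `|t| <= e -> conv_hull v (v j + t *: u).
  move=> te; apply/Q => k.
  have -> : afev (F k) (v j + t *: u) = c k + t * m k.
    by rewrite /c /m /afev !mxE; ring.
  have : `|t * m k| <= c k.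
    by rewrite normrM (le_trans _ (small k)) // ler_wpM2r.
  by rewrite ler_norml => /andP[h _]; lra.
have [r [r0 r1 rE]] : conv_hull v (v j + e *: u) by apply: move_in; rewrite gtr0_norm.
have [s [s0 s1 sE]] : conv_hull v (v j + (- e) *: u).
  by apply: move_in; rewrite normrN gtr0_norm.
(* Averaging the weights of the two opposite displacements represents [v j] itself, so all the
   weight sits at [j]; then [r j = 1] as well, and the displacement is zero. *)
have h : 2^-1 * (r j + s j) = 1.
  apply: (conv_hull_weight1 (r := fun i => 2^-1 * (r i + s i)) (out j)) => [i||].
  - by rewrite mulr_ge0 ?addr_ge0 // invr_ge0.
  - by rewrite -mulr_sumr big_split /= r1 s1; field.
  - under eq_bigr => i _ do rewrite -scalerA scalerDl.
    rewrite -scaler_sumr big_split /= -rE -sE.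
    by apply/rowP => i; rewrite !mxE; field.
have le1 : r j <= 1 by rewrite -r1 (bigD1 j) //= lerDl sumr_ge0.
have le1' : s j <= 1 by rewrite -s1 (bigD1 j) //= lerDl sumr_ge0.
have rj : r j = 1 by lra.
have other i : i != j -> r i = 0.
  move=> ij; move: r1; rewrite (bigD1 j) //= rj -[RHS]addr0 => /addrI /eqP.
  by rewrite psumr_eq0 // => /allP/(_ i (mem_index_enum i)); rewrite ij => /eqP.
move: rE; rewrite (bigD1 j) //= rj scale1r big1 => [|i /other ->]; last exact: scale0r.
move=> /addrI /eqP; rewrite scaler_eq0 (negbTE u0) orbF => /eqP ez.
by rewrite ez ltxx in e0.
Qed.

(* The sides of the quadrilateral will be the vertices of a graph, and its corners
   the edges. *)
Definition incident (x : nat) (e : nat * nat) : bool := (x == e.1) || (x == e.2).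

(** The last clause allows at most one edge of [es] at either endpoint of [e], so that adding [e]
    keeps all degrees at most 2. *)
Definition compatible (e : nat * nat) (es : seq (nat * nat)) : bool :=
  [&& e.1 != e.2, all (fun e' => ~~ (incident e.1 e' && incident e.2 e')) es &
   all (fun x => all (fun e1 => all (fun e2 =>
     (e1 == e2) || ~~ (incident x e1 && incident x e2)) es) es) [:: e.1; e.2]].

Fixpoint maxdeg2 (es : seq (nat * nat)) : bool :=
  if es is e :: es' then compatible e es' && maxdeg2 es' else true.

(* Walks along the graph with edges [es], starting with the edge of index [0], and
   checks that the walk is a 4-cycle [x1 - x2 - x3 - x4 - x1], where the edge
   joining two consecutive vertices has index [0], [j2], [j3], [j4]. *)
Definition cycle_walk (es : seq (nat * nat)) : seq nat * seq nat :=
  let e := nth (0, 0)%N es in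
  let other x j := if x == (e j).1 then (e j).2 else (e j).1 in
  let next x j := find (fun i => (i != j) && incident x (e i)) [:: 0; 1; 2; 3]%N in
  let x2 := (e 0%N).2 in let j2 := next x2 0%N in
  let x3 := other x2 j2 in let j3 := next x3 j2 in
  let x4 := other x3 j3 in let j4 := next x4 j3 in
  ([:: (e 0%N).1; x2; x3; x4], [:: 0%N; j2; j3; j4]).

(** The walk is only a candidate certificate, verified here, so no property of [cycle_walk] has to
    be proved. The bound 4 rejects the index 4 that [find] returns on failure. *)
Definition is_4cycle (es : seq (nat * nat)) (w : seq nat * seq nat) : bool :=
  if w is ([:: x1; x2; x3; x4], [:: j1; j2; j3; j4]) then
    let e := nth (0, 0)%N es in
    [&& uniq w.1, all (gtn 4) w.1, uniq w.2, all (gtn 4) w.2,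
      incident x1 (e j1) && incident x2 (e j1),
      incident x2 (e j2) && incident x3 (e j2),
      incident x3 (e j3) && incident x4 (e j3) &
      incident x4 (e j4) && incident x1 (e j4)]
  else false.

Definition all_pairs4 := [seq (x, y) | x <- iota 0 4, y <- iota 0 4].

Fixpoint search4 (n : nat) (es : seq (nat * nat)) : bool :=
  if n is n'.+1 then
    all (fun e => if compatible e es then search4 n' (e :: es) else true) all_pairs4
  else is_4cycle es (cycle_walk es).

Arguments all_pairs4 : simpl never.
Arguments is_4cycle : simpl never.
Arguments cycle_walk : simpl never.

(** Four edges on four vertices have degree sum 8, so degrees at most 2 are all equal to 2, and a
    simple 2-regular graph on four vertices is a 4-cycle. The computation confirms this, with the
    walk, for every labelled list of edges. *)
Lemma search4_true : search4 4 [::].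
Proof. by vm_compute. Qed.

Lemma maxdeg2_catrev s es : maxdeg2 (catrev s es) -> maxdeg2 es.
Proof. by elim: s es => //= e s IH es /IH /= /andP[]. Qed.

(** The search puts each new edge at the head of its accumulator, hence [catrev]. *)
Lemma search4P n es : search4 n es -> forall s, size s = n ->
  {subset s <= all_pairs4} -> maxdeg2 (catrev s es) ->
  is_4cycle (catrev s es) (cycle_walk (catrev s es)).
Proof.
elim: n es => [|n IH] es h [|e s] //= [sz] sub ok.
have /allP/(_ e) := h; rewrite sub ?mem_head // => /(_ isT).
have /= /andP[-> _] := maxdeg2_catrev ok => /IH; apply=> // x xs.
by apply: sub; rewrite inE xs orbT.
Qed.

Lemma four_cycle (k l : 'I_4 -> 'I_4) (e := fun x j => (x == k j) || (x == l j)) :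
  (forall j, k j != l j) ->
  (forall i j, i != j -> ~~ (e (k i) j && e (l i) j)) ->
  (forall x i j m, i != j -> j != m -> i != m -> ~~ [&& e x i, e x j & e x m]) ->
  exists x1 x2 x3 x4 j1 j2 j3 j4,
    [/\ forall x, x \in [:: x1; x2; x3; x4], uniq [:: j1; j2; j3; j4] &
     [/\ e x1 j1 && e x2 j1, e x2 j2 && e x3 j2, e x3 j3 && e x4 j3 &
      e x4 j4 && e x1 j4]].
Proof.
move=> kl pairs deg.
pose E j : nat * nat := (val (k j), val (l j)).
have eE x j : incident (val x) (E j) = e x j by [].
have ok (s : seq 'I_4) : uniq s -> maxdeg2 (map E s).
  elim: s => //= j s IH /andP[js /IH ->]; rewrite andbT; apply/and3P; split.
  - exact: kl.
  - apply/allP => _ /mapP[i si ->]; rewrite !eE; apply: pairs.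
    by apply: contraNneq js => ->.
  - apply/allP => x xE; apply/allP => _ /mapP[i si ->]; apply/allP => _ /mapP[m sm ->].
    have [//|EE] := eqVneq (E i) (E m); rewrite orFb.
    have ji : j != i by apply: contraNneq js => ->.
    have jm : j != m by apply: contraNneq js => ->.
    have im : i != m by apply: contraNneq EE => ->.
    have [y -> yj] : exists2 y : 'I_4, x = val y & e y j.
      move: xE; rewrite !inE => /orP[] /eqP->; [exists (k j)|exists (l j)] => //.
        by rewrite /e eqxx.
      by rewrite /e eqxx orbT.
    by have := deg y j i m ji im jm; rewrite yj !eE.
pose es := map E (enum 'I_4).
have : is_4cycle es (cycle_walk es).
  have -> : es = catrev (rev es) [::] by rewrite catrevE revK cats0.
  apply: (search4P search4_true).
  - by rewrite size_rev size_map size_enum_ord.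
  - move=> p; rewrite mem_rev => /mapP[j _ ->].
    by apply/allpairsP; exists (E j); rewrite !mem_iota /= !ltn_ord.
  - by rewrite catrevE revK cats0; apply: ok; rewrite enum_uniq.
case: (cycle_walk es) => [[|x1 [|x2 [|x3 [|x4 [|? ?]]]]] [|j1 [|j2 [|j3 [|j4 [|? ?]]]]]] //.
move=> /and5P[ux ax uj aj h].
have nthE j : (j < 4)%N -> nth (0, 0)%N es j = E (inord j).
  move=> lt_j; rewrite (nth_map ord0) ?size_enum_ord //; congr E.
  by apply: val_inj; rewrite /= nth_enum_ord // inordK.
have inc x j : (x < 4)%N -> (j < 4)%N ->
    incident x (nth (0, 0)%N es j) -> e (inord x) (inord j).
  by move=> x4' j4'; rewrite nthE // -eE /= inordK.
have inordI : {in gtn 4 &, injective (@inord 3)}.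
  by move=> x y xi yi /(congr1 val) /=; rewrite !inordK.
exists (inord x1), (inord x2), (inord x3), (inord x4).
exists (inord j1), (inord j2), (inord j3), (inord j4).
split.
- have uX : uniq (map (@inord 3) [:: x1; x2; x3; x4]).
    rewrite map_inj_in_uniq // => x y xi yi; apply: inordI.
      exact: (allP ax).
    exact: (allP ax).
  have [|_ mem4] := uniq_min_size uX (fun x _ => mem_enum 'I_4 x).
    by rewrite size_enum_ord.
  by move=> x; have := mem4 x; rewrite mem_enum.
- rewrite -[X in uniq X]/(map (@inord 3) [:: j1; j2; j3; j4]).
  rewrite map_inj_in_uniq // => x y xi yi; apply: inordI.
    exact: (allP aj).
  exact: (allP aj).
- move: ax aj => /and5P[a1 a2 a3 a4 _] /and5P[b1 b2 b3 b4 _].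
  by case/and4P: h => /andP[? ?] /andP[? ?] /andP[? ?] /andP[? ?]; split; apply/andP;
    split; apply: inc.
Qed.

(** The graph conditions are geometric: the two sides chosen at a corner differ because they are not
    parallel, two corners sharing both sides would coincide, and no side contains three corners.
    This last fact also makes each side strictly positive at the two corners off it. *)
Lemma quadrilateral_frame (R : realType) (F : 'I_4 -> 'rV[R]_3) (v : 'I_4 -> 'rV[R]_2) :
  (forall k, F k 0 0 = 1) -> extreme_points v ->
  (forall p, (forall k, 0 <= afev (F k) p) <-> conv_hull v p) ->
  exists f1 f2 f3 f4 a b d,
    [/\ rescaled F [:: f1; f2; f3; f4], detf f1 f2 != 0 &
      quad_frame (delta_mx 0 0) f1 f2 f3 f4 a b d].
Proof.
move=> F1 out Q.
have [k /fin_all_exists[l kl]] := fin_all_exists (fun j =>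
  extreme_point_active_pair j out F1 Q).
pose e x j := (x == k j) || (x == l j).
have act x j : e x j -> afev (F x) (v j) = 0.
  by have [h1 h2 _] := kl j; case/orP => /eqP->.
have pos x j : 0 <= afev (F x) (v j).
  apply: (Q (v j)).2 => {x}; exists (fun i => (i == j)%:R); split=> [i||].
  - exact: ler0n.
  - by rewrite (bigD1 j) //= big1 ?eqxx ?addr0 // => i /negbTE->.
  - rewrite (bigD1 j) //= big1 ?eqxx ?scale1r ?addr0 // => i /negbTE->.
    exact: scale0r.
have [] := @four_cycle k l.
- move=> j; have [_ _] := kl j; apply: contraNneq => ->.
  by rewrite /detf mulrC subrr.
- move=> i j ij; apply: contra_neqN ij => /andP[/act h1 /act h2].
  have [g1 g2 D] := kl i; apply: (extreme_points_inj out).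
  exact: afev_common_zero D g1 g2 h1 h2.
- move=> x i j m ij jm im; apply/and3P => -[/act hi /act hj /act hm].
  exact: extreme_points_not_collinear out (F1 x) hi hj hm ij jm im.
move=> x1 [x2 [x3 [x4 [j1 [j2 [j3 [j4 [all_x]]]]]]]].
rewrite /= !inE !negb_or => /and4P[/and3P[n12 n13 n14] /andP[n23 n24] n34 _].
case=> /andP[/act z11 /act z21] /andP[/act z22 /act z32].
move=> /andP[/act z33 /act z43] /andP[/act z44 /act z14].
have gt0 x i j m : afev (F x) (v i) = 0 -> afev (F x) (v j) = 0 ->
    i != j -> m != i -> m != j -> 0 < afev (F x) (v m).
  move=> hi hj ij mi mj; rewrite lt_neqAle pos andbT; apply/negP => /eqP hm.
  by apply: (extreme_points_not_collinear out (F1 x) hi hj (esym hm) ij);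
    rewrite eq_sym.
have [] := @quad_frame_exists R (F x1) (F x2) (F x3) (F x4) (v j1) (v j2) (v j3) (v j4);
  rewrite //.
- by apply: (gt0 _ j2 j3).
- by apply: (gt0 _ j3 j4).
- by apply: (gt0 _ j3 j4); rewrite // eq_sym.
- by apply: (gt0 _ j1 j4); rewrite // eq_sym.
- by apply: (gt0 _ j1 j4); rewrite // eq_sym.
- by apply: (gt0 _ j1 j2); rewrite // eq_sym.
- by apply: (gt0 _ j1 j2); rewrite // eq_sym.
- by apply: (gt0 _ j2 j3); rewrite // eq_sym.
move=> c1 [c2 [c3 [c4 [a [b [d [[p1 p2 p3 p4] D H]]]]]]].
exists (c1 *: F x1), (c2 *: F x2), (c3 *: F x3), (c4 *: F x4), a, b, d; split=> //.
  split=> [x|f].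
    have inv c : 0 < c -> exists2 c', 0 < c' & F x = c' *: (c *: F x).
      move=> c0; exists c^-1; rewrite ?invr_gt0 //.
      by rewrite scalerA mulVf ?lt0r_neq0 // scale1r.
    have := all_x x; rewrite !inE => /or4P[] /eqP xE.
    - by exists (c1 *: F x1); rewrite ?inE ?eqxx // -xE; apply: inv.
    - by exists (c2 *: F x2); rewrite ?inE ?eqxx ?orbT // -xE; apply: inv.
    - by exists (c3 *: F x3); rewrite ?inE ?eqxx ?orbT // -xE; apply: inv.
    - by exists (c4 *: F x4); rewrite ?inE ?eqxx ?orbT // -xE; apply: inv.
  rewrite !inE => /or4P[] /eqP->.
  - by exists x1, c1.
  - by exists x2, c2.
  - by exists x3, c3.
  - by exists x4, c4.
have -> : detf (c1 *: F x1) (c2 *: F x2) = c1 * c2 * detf (F x1) (F x2).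
  by rewrite /detf /cx /cy !mxE; ring.
by rewrite !mulf_neq0 // lt0r_neq0.
Qed.

Lemma free_quadrilateral_frame (R : realType) (K : freeset R 2) :
  free_quadrilateral K ->
  exists (F : 'I_4 -> 'rV[R]_3) (f1 f2 f3 f4 : 'rV[R]_3) (a b d : R),
    [/\ forall k, F k 0 0 = 1, freeset_eq K (halfspaces F),
      rescaled F [:: f1; f2; f3; f4], detf f1 f2 != 0 &
      quad_frame (delta_mx 0 0) f1 f2 f3 f4 a b d].
Proof.
move=> [_ [v [out hv]] [C [dC KC]]].
have KF : freeset_eq K (halfspaces (diag_form C)).
  by move=> n X; rewrite (KC n X); apply: free_spectrahedron_diag.
have Q p : (forall k, 0 <= afev (diag_form C k) p) <-> conv_hull v p.
  by rewrite -hv -level1_halfspaces; split=> /KF.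
have [f1 [f2 [f3 [f4 [a [b [d [h1 h2 h3]]]]]]]] :=
  quadrilateral_frame (diag_form0 C) out Q.
by exists (diag_form C), f1, f2, f3, f4, a, b, d; split=> //; apply: diag_form0.
Qed.

Theorem theorem1p3 (R : realType) (d : nat) (A : mxtuple R 2 d)
    (hA : SM A) (hquad : free_quadrilateral (free_spectrahedron A)) :
  exists p : 'I_4 -> ncpoly R 2,
    (forall i, ncdeg_le (p i) 3) /\
    forall (n : nat) (X : mxtuple R 2 n), SM X ->
      (arveson_boundary (free_spectrahedron A) X <->
       (free_spectrahedron A X /\ forall i, nceval (p i) X = 0)).
Proof.
have [F [f1 [f2 [f3 [f4 [a [b [c [F1 AF Ff D Q]]]]]]]]] := free_quadrilateral_frame hquad.
pose cubic (f w h : 'rV[R]_3) := affpoly f * affpoly w * affpoly h.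
pose w1 := weight a b c f2 (f1 + f3).
(* The weight of the reflected frame, with [a] and [b] exchanged. *)
pose w2 := weight b a c f1 (f2 + f4).
exists (fun i => if i == ord0 then cubic f1 w1 f3 else cubic f2 w2 f4).
have deg f w h : ncdeg_le (cubic f w h) 3.
  apply: (@ncdeg_leM _ _ _ _ 2 1); last exact: ncdeg_le_affpoly.
  by apply: (@ncdeg_leM _ _ _ _ 1 1); apply: ncdeg_le_affpoly.
split=> [i|n X sX]; first by case: ifP.
have ev f w h : nceval (cubic f w h) X = affmx X f *m affmx X w *m affmx X h.
  transitivity (nceval (affpoly f * affpoly w) X *m nceval (affpoly h) X).
    exact: ncevalM.
  rewrite nceval_affpoly; congr (_ *m _).
  transitivity (nceval (affpoly f) X *m nceval (affpoly w) X); first exact: ncevalM.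
  by congr (_ *m _); apply: nceval_affpoly.
have := quad_frame_linear (affmx X) Q; rewrite /= affmx_delta0 => QX.
have wE x y z f g h :
    affmx X (weight x y z f (g + h)) = weight x y z (affmx X f) (affmx X g + affmx X h).
  have /= gh := linearD (affmx X) g h.
  by rewrite -gh /weight (linearD (affmx X) (_ *: f)) !linearZ.
rewrite (arveson_boundary_eq X AF) (AF n X).
have psd : halfspaces F X -> forall f, f \in [:: f1; f2; f3; f4] -> psdmx (affmx X f).
  by move=> [_ pX]; apply: rescaled_psd Ff pX.
split=> [arv|[hX h]].
  have hX := arv.1; split=> // i.
  have [r13 r24] := arveson_quad_rank F1 Ff Q arv.
  have p f (fs : f \in [:: f1; f2; f3; f4]) := psd hX f fs.
  case: ifP => _; rewrite ev wE.
    by apply: (quad_frame_cubic QX) => //; apply: p; rewrite !inE eqxx ?orbT.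
  by apply: (quad_frame_cubic (quad_frame_sym QX)) => //; apply: p;
    rewrite !inE eqxx ?orbT.
have p f (fs : f \in [:: f1; f2; f3; f4]) := psd hX f fs.
have W1 : posdefmx (affmx X w1).
  rewrite wE.
  by apply: (quad_frame_weight_posdef QX); apply: p; rewrite !inE eqxx ?orbT.
have W2 : posdefmx (affmx X w2).
  rewrite wE.
  by apply: (quad_frame_weight_posdef (quad_frame_sym QX)); apply: p;
    rewrite !inE eqxx ?orbT.
apply: (quad_rank_arveson Ff Q D hX).
  by apply: (unitmx_mul_between W1.2); have := h ord0; rewrite /= ev.
by apply: (unitmx_mul_between W2.2); have := h ord_max; rewrite /= ev.
Qed.
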